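(* Let $n\ge2$ be even, $G_{\mathbb R}=SO^*(2n)$, and let $p$ be an even integer with $0\le p\le n$. Put $r=\frac p2$ and $s=\frac{n-p}2$. Then the constant $c_p^n$ (as defined in the context) for the real form of $\mathcal O^{\mathbb C}$ corresponding to $p$, i.e. to $h=h_p=(\underbrace{1,\dots,1}_{p}\,|\,\underbrace{-1,\dots,-1}_{n-p})$, is $$c_p^n=(-1)^{\frac p2}\binom{r+s}{r}.$$
   Context: Notation: $\mathfrak g=\mathfrak{so}(2n,\mathbb C)$ with Cartan decomposition $\mathfrak g=\mathfrak k\oplus\mathfrak p$, $\mathfrak k\cong\mathfrak{gl}(n,\mathbb C)$, and $\mathfrak h\subset\mathfrak k$ is a Cartan subalgebra. $\mathfrak h$ and $\mathfrak h^*$ are identified with $\mathbb C^n$ with standard coordinates $\varepsilon_1,\dots,\varepsilon_n$ and standard bilinear form $\langle\ ,\ \rangle$. Positive roots: $\Delta^+=\{\varepsilon_i\pm\varepsilon_j\mid i<j\}$. Compact roots: $\pm(\varepsilon_i-\varepsilon_j)$, $i<j$; noncompact roots: $\pm(\varepsilon_i+\varepsilon_j)$, $i<j$. Set $\Delta_c^+=\{\varepsilon_i-\varepsilon_j\mid i<j\}$, $\rho_c$ half their sum, and $$P_K(\lambda)=\prod_{\alpha\in\Delta_c^+}\frac{\langle\lambda,\alpha\rangle}{\langle\rho_c,\alpha\rangle}.$$ $\mathcal O^{\mathbb C}$ is the complex nilpotent orbit with partition $[2^n]$ considered in the paper; its real forms are nilpotent $K$-orbits in $\mathfrak p$ (where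 $K$ is the complexification of the maximal compact subgroup), and $h$ is the semisimple element of the $\mathfrak{sl}_2$-triple of the real form. Definition of the constant attached to $h$. Let $\mathfrak l$ be the centralizer of $h$ in $\mathfrak g$, $\Delta(\mathfrak l)=\{\alpha\mid\alpha(h)=0\}$ its roots, $\Delta^+(\mathfrak l)=\Delta(\mathfrak l)\cap\Delta^+$, and $\Delta_n^+(\mathfrak l)$ the set of noncompact roots in $\Delta^+(\mathfrak l)$, with half sum $\rho_n(\mathfrak l)$. $P_{L\cap K}$ is the Weyl dimension polynomial of $\mathfrak l\cap\mathfrak k$, i.e. $P_{L\cap K}(\lambda)=\prod\langle\lambda,\alpha\rangle/\langle\rho_{\mathfrak l\cap\mathfrak k},\alpha\rangle$, the product over compact $\alpha\in\Delta^+(\mathfrak l)$ and $\rho_{\mathfrak l\cap\mathfrak k}$ being half the sum of these roots. Let $\Delta(\mathfrak p_1)$ be the set of noncompact roots $\alpha$ with $\alpha(h)=1$, let $N=\#\{\alpha\in\Delta^+\mid\alpha(h)>0\}$, and for a set $A$ of roots let $\rho(A)$ be half the sum of its elements. The constant $c=c(h)$ is defined by the polynomial identity in $\lambda\in\mathfrak h^*$ $$(-1)^N\sum_{A\subseteq\Delta_n^+(\mathfrak l),\ C\subseteq\Delta(\mathfrak p_1)}(-1)^{\#A+\#C}P_K(\lambda-\rho_n(\mathfrak l)+2\rho(A)-2\rho(C))=c\,P_{L\cap K}(\lambda);$$ it is known from earlier work that the left side is a constant multiple of $P_{L\cap K}$. *)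

(* Defs.v *)
From mathcomp Require Export all_boot all_order all_algebra.
From mathcomp Require Export finmap.
From mathcomp Require Export complex.
From mathcomp Require Export reals.

Set Implicit Arguments.
Unset Strict Implicit.
Unset Printing Implicit Defensive.

Import Order.TTheory GRing.Theory Num.Theory.

Local Open Scope fset_scope.
Local Open Scope complex_scope.
Local Open Scope ring_scope.

(* Root data of so(2n, C) with k = gl(n, C), the complexified maximal compact
   subalgebra of so*(2n).  The Cartan subalgebra and its dual are both
   identified with C^n = 'rV[R[i]]_n, the pairing being the standard bilinear
   (not Hermitian) form; roots are literally vectors of C^n. *)
Section RootData.

Variables (R : realType) (n : nat).
Local Notation C := R[i].
Local Notation V := 'rV[C]_n.

Definition eps (i : 'I_n) : V := delta_mx 0 i.

Definition form (x y : V) : C := \sum_(i < n) x 0 i * y 0 i.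

Definition pos_compact_roots : {fset V} :=
  [fset eps ij.1 - eps ij.2 | ij : 'I_n * 'I_n & (ij.1 < ij.2)%N].

Definition pos_noncompact_roots : {fset V} :=
  [fset eps ij.1 + eps ij.2 | ij : 'I_n * 'I_n & (ij.1 < ij.2)%N].

Definition pos_roots : {fset V} := pos_compact_roots `|` pos_noncompact_roots.

Definition compact_roots : {fset V} :=
  pos_compact_roots `|` [fset - a | a in pos_compact_roots].

Definition noncompact_roots : {fset V} :=
  pos_noncompact_roots `|` [fset - a | a in pos_noncompact_roots].

Definition roots : {fset V} := compact_roots `|` noncompact_roots.

Definition rho (A : {fset V}) : V := 2^-1 *: \sum_(a <- A) a.

Definition weyl_dim_poly (A : {fset V}) (lambda : V) : C :=
  \prod_(a <- A) (form lambda a / form (rho A) a).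

Definition P_K : V -> C := weyl_dim_poly pos_compact_roots.

Definition levi_roots (h : V) : {fset V} :=
  [fset a in roots | form a h == 0].

Definition pos_levi_roots (h : V) : {fset V} := levi_roots h `&` pos_roots.

Definition pos_noncompact_levi_roots (h : V) : {fset V} :=
  pos_levi_roots h `&` noncompact_roots.

Definition pos_compact_levi_roots (h : V) : {fset V} :=
  pos_levi_roots h `&` compact_roots.

Definition P_LK (h : V) : V -> C := weyl_dim_poly (pos_compact_levi_roots h).

Definition p1_roots (h : V) : {fset V} :=
  [fset a in noncompact_roots | form a h == 1].

(* In the partial order of R[i], 0 < z means that z is real and positive. *)
Definition num_pos_on (h : V) : nat :=
  #|` [fset a in pos_roots | 0 < form a h] |.

Definition alternating_sum (h lambda : V) : C :=
  (-1) ^+ num_pos_on h *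
  \sum_(A <- fpowerset (pos_noncompact_levi_roots h))
    \sum_(B <- fpowerset (p1_roots h))
      (-1) ^+ (#|` A| + #|` B|) *
      P_K (lambda - rho (pos_noncompact_levi_roots h)
             + 2 *: rho A - 2 *: rho B).

(* C is infinite, so equality at every lambda is the polynomial identity. *)
Definition is_constant_of (h : V) (c : C) : Prop :=
  forall lambda : V, alternating_sum h lambda = c * P_LK h lambda.

Definition h_real_form (p : nat) : V :=
  \row_(i < n) (if (i < p)%N then 1 else -1).

End RootData.

(* Main.v *)
(** Every noncompact root takes the value 2, 0 or -2 on [h], so [Delta(p_1)] is
    empty and, up to sign, the left side is the alternating sum [F] of shifts of
    the Vandermonde polynomial [V_n], i.e. the image of [V_n] under the product
    of the pq central difference operators in the directions
    [eps_i + eps_j], [i <= p < j], [q = n - p].  Each of them lowers the degree,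
    so [deg F <= p(p-1)/2 + q(q-1)/2]; as [F] is alternating under [S_p x S_q],
    it is a multiple of [V_p(x) V_q(y)].

    To find the factor, antisymmetrize the values of [F] at the points
    [(s(i) + q/2, - t(j) - p/2)], [s] in [S_p], [t] in [S_q].  The Laurent
    polynomial of the resulting signed measure is
    [V_p(X) V_q(Y) prod_(i,j) (Y_j - X_i) = V_n(X, Y)], so this equals
    [sum_pi sgn(pi) V_n(pi_1, .., pi_p, - pi_(p+1), .., - pi_n)], which
    factors as [V_n(0, .., n-1)] times
    [sum_tau (-1)^(sum of the k with tau(k) > p)
       = p! q! e_q(1, -1, 1, -1, ..)].
    For p = 2r and q = 2s the elementary symmetric function is the coefficient of
    [z^(2s)] in [(1 - z^2)^(r+s)], whence the binomial coefficient. *)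
Require Import Defs.
From mathcomp Require Import fingroup perm ring zify mpoly finmap.

Import Order.TTheory GRing.Theory Num.Theory.
Local Open Scope complex_scope.
Local Open Scope ring_scope.

Set Implicit Arguments.
Unset Strict Implicit.
Unset Printing Implicit Defensive.

(** * Degree of polynomial functions and difference operators *)

(** Only the zero function has degree < 0, so that [d.-1] is the right bound in
    [degree_lt_diff] also for constants and for [d = 0]. *)
Inductive degree_lt (K : comNzRingType) (n : nat) :
    nat -> ('rV[K]_n -> K) -> Prop :=
| degree_lt_zero d : degree_lt d (fun _ => 0)
| degree_lt_const d c : degree_lt d.+1 (fun _ => c)
| degree_lt_coord d i f : degree_lt d f -> degree_lt d.+1 (fun x => x 0 i * f x)
| degree_lt_add d f g :
    degree_lt d f -> degree_lt d g -> degree_lt d (fun x => f x + g x)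
| degree_lt_ext d f g : f =1 g -> degree_lt d f -> degree_lt d g.

Section Degree.

Variables (K : comNzRingType) (n : nat).
Implicit Types (f g : 'rV[K]_n -> K) (v : 'rV[K]_n).

Lemma degree_ltW d e f : (d <= e)%N -> degree_lt d f -> degree_lt e f.
Proof.
move=> le_de df; elim: df e le_de => {d f}.
- by move=> *; apply: degree_lt_zero.
- by move=> d c [//|e] _; apply: degree_lt_const.
- by move=> d i f _ IH [//|e] /IH; apply: degree_lt_coord.
- by move=> d f g _ IHf _ IHg e le_de; apply: degree_lt_add; auto.
- by move=> d f g fg _ IH e /IH; apply: degree_lt_ext.
Qed.

Lemma degree_lt_scale d c f : degree_lt d f -> degree_lt d (fun x => c * f x).
Proof.
elim=> {d f}.
- move=> d; apply: (degree_lt_ext (f := fun=> 0)) => [x|]; first by rewrite mulr0.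
  exact: degree_lt_zero.
- by move=> d c'; apply: degree_lt_const.
- move=> d i f _ IH.
  apply: (degree_lt_ext (f := fun x => x 0 i * (c * f x))) => [x|].
    by rewrite mulrCA.
  exact: degree_lt_coord.
- move=> d f g _ IHf _ IHg.
  apply: (degree_lt_ext (f := fun x => c * f x + c * g x)) => [x|].
    by rewrite mulrDr.
  exact: degree_lt_add.
- move=> d f g fg _; apply: degree_lt_ext => x; by rewrite fg.
Qed.

Lemma degree_lt_sum (I : Type) (r : seq I) (P : pred I) d (F : I -> 'rV[K]_n -> K) :
    (forall i, P i -> degree_lt d (F i)) ->
  degree_lt d (fun x => \sum_(i <- r | P i) F i x).
Proof.
move=> dF; elim: r => [|i r IH].
  apply: (degree_lt_ext (f := fun=> 0)) => [x|]; first by rewrite big_nil.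
  exact: degree_lt_zero.
case Pi: (P i); last first.
  by apply: degree_lt_ext IH => x; rewrite big_cons Pi.
apply: degree_lt_ext (degree_lt_add (dF i Pi) IH) => x.
by rewrite big_cons Pi.
Qed.

Lemma degree_lt0 f : degree_lt 0 f -> f =1 (fun=> 0).
Proof.
suff gen d : degree_lt d f -> d = 0%N -> f =1 (fun=> 0) by move/gen; apply.
elim=> {d f} //.
- by move=> d f g _ IHf _ IHg d0 x; rewrite IHf ?IHg ?addr0.
- by move=> d f g fg _ IH d0 x; rewrite -fg IH.
Qed.

Lemma degree_lt_coordX d k i f :
  degree_lt d f -> degree_lt (k + d) (fun x => x 0 i ^+ k * f x).
Proof.
move=> df; elim: k => [|k IH].
  by apply: degree_lt_ext df => x; rewrite mul1r.
by apply: degree_lt_ext (degree_lt_coord i IH) => x; rewrite exprS mulrA.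
Qed.

Lemma degree_lt_monomial (I : Type) (r : seq I) (g : I -> 'I_n) (e : I -> nat) :
  degree_lt (\sum_(i <- r) e i).+1 (fun x : 'rV[K]_n => \prod_(i <- r) x 0 (g i) ^+ e i).
Proof.
elim: r => [|i r IH].
  apply: (degree_lt_ext (f := fun=> 1)) => [x|]; first by rewrite big_nil.
  exact: degree_lt_const.
rewrite big_cons -addnS.
by apply: degree_lt_ext (degree_lt_coordX (e i) (g i) IH) => x; rewrite big_cons.
Qed.

Lemma degree_lt_shift d f v : degree_lt d f -> degree_lt d (fun x => f (x + v)).
Proof.
elim=> {d f}.
- by move=> *; apply: degree_lt_zero.
- by move=> *; apply: degree_lt_const.
- move=> d i f _ IH.
  apply: (degree_lt_ext
            (f := fun x => x 0 i * f (x + v) + v 0 i * f (x + v))) => [x|].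
    by rewrite mxE mulrDl.
  apply: degree_lt_add; first exact: degree_lt_coord.
  by apply: degree_lt_scale; apply: degree_ltW IH.
- by move=> d f g _ IHf _ IHg; apply: degree_lt_add.
- by move=> d f g fg _; apply: degree_lt_ext => x; rewrite fg.
Qed.

(** A product rule drives the induction: the difference of [x_i f] is [x_i] times the difference of
    [f], minus [v_i] times the sum of the two shifts of [f]. Both terms have degree one less than
    [x_i f]. *)
Lemma degree_lt_diff d f v :
  degree_lt d f -> degree_lt d.-1 (fun x => f (x - v) - f (x + v)).
Proof.
elim=> {d f}.
- move=> d; apply: (degree_lt_ext (f := fun=> 0)) => [x|]; first by rewrite subr0.
  exact: degree_lt_zero.
- move=> d c; apply: (degree_lt_ext (f := fun=> 0)) => [x|]; first by rewrite subrr.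
  exact: degree_lt_zero.
(* For [d = 0] the truncated predecessor gives no drop in the induction hypothesis, but then [f]
   vanishes identically. *)
- move=> [|d] i f df IH.
    apply: (degree_lt_ext (f := fun=> 0)) => [x|]; last exact: degree_lt_zero.
    by rewrite !(degree_lt0 df) !mulr0 subr0.
  apply: (degree_lt_ext (f := fun x => x 0 i * (f (x - v) - f (x + v))
            + (- v 0 i) * (f (x - v) + f (x + v)))) => [x|].
    by rewrite !mxE; ring.
  apply: degree_lt_add; first exact: degree_lt_coord.
  by apply: degree_lt_scale; apply: degree_lt_add; apply: degree_lt_shift.
- move=> d f g _ IHf _ IHg; apply: degree_lt_ext (degree_lt_add IHf IHg) => x.
  by ring.
- by move=> d f g fg _; apply: degree_lt_ext => x; rewrite !fg.
Qed.

Definition signed_sum (T : finType) (v : T -> 'rV[K]_n) (B A : {set T}) :=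
  \sum_(t in A) v t - \sum_(t in B :\: A) v t.

(** The commuting operators sending [f] to [f (x - v t) - f (x + v t)], composed over [t] in [B] and
    expanded: [A] is the set of [t] at which the term with [+ v t] is taken. *)
Definition alternating_shift (T : finType) (v : T -> 'rV[K]_n) (B : {set T}) f x :=
  \sum_(A in powerset B) (-1) ^+ #|A| * f (x + signed_sum v B A).

(** Induction on the size of [B]. For [t] in [B], pairing each subset avoiding [t] with the one
    obtained by adding [t] gives the alternating shift over [B :\ t] of the difference of [f] along
    [v t], and each difference lowers the degree. *)
Lemma degree_lt_alternating_shift (T : finType) (v : T -> 'rV[K]_n) (B : {set T})
    d f : degree_lt d f -> degree_lt (d - #|B|) (alternating_shift v B f).
Proof.
move: {2}#|B| (erefl #|B|) => m; elim: m B d f => [|m IH] B d f.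
  move=> /eqP; rewrite cards_eq0 => /eqP -> df.
  rewrite cards0 subn0; apply: degree_lt_ext df => x.
  rewrite /alternating_shift powerset0 big_set1 /signed_sum setD0 !big_set0.
  by rewrite cards0 subr0 addr0 mul1r.
move=> cB df; have [t tB] : exists t, t \in B by apply/card_gt0P; rewrite cB.
set B' := B :\ t.
have cB' : #|B'| = m by move: cB; rewrite (cardsD1 t) tB => -[].
have := IH B' d.-1 _ cB' (degree_lt_diff (v t) df).
rewrite cB cB' -subn1 -subnDA add1n; apply: degree_lt_ext => x.
rewrite /alternating_shift [RHS](bigID (fun A : {set T} => t \in A)) /= addrC.
have eqP1 : (fun A : {set T} => (A \in powerset B) && (t \notin A))
    =1 (fun A => A \in powerset B').
  by move=> A; rewrite !powersetE subsetD1.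
rewrite (eq_bigl _ _ eqP1).
rewrite [X in _ = _ + X](reindex_onto (fun A => t |: A) (fun A => A :\ t));
  rewrite /=; last first.
  by move=> A /andP[_ tA]; rewrite setD1K.
have eqP2 : (fun A : {set T} => [&& t |: A \in powerset B, t \in t |: A &
    (t |: A) :\ t == A]) =1 (fun A => A \in powerset B').
  move=> A; rewrite !powersetE subsetD1 setU11 subUset sub1set tB /=.
  case tA: (t \in A); last by rewrite setU1K ?tA ?eqxx.
  rewrite andbF; apply/negbTE/negP => /andP[_ /eqP E].
  by move: tA; rewrite -E !inE eqxx.
under [X in _ = _ + X]eq_bigl => A do rewrite -andbA eqP2.
rewrite -big_split /=; apply: eq_bigr => A; rewrite powersetE => /subsetD1P[AB tA].
have E1 : signed_sum v B A = signed_sum v B' A - v t.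
  rewrite /signed_sum [X in _ - X = _](big_setD1 t) ?inE ?tB ?tA //= /B'.
  have -> : (B :\: A) :\ t = (B :\ t) :\: A.
    by apply/setP => z; rewrite !inE; case: (z == t); case: (z \in A).
  by rewrite opprD addrA addrAC.
have E2 : signed_sum v B (t |: A) = signed_sum v B' A + v t.
  rewrite /signed_sum big_setU1 //= /B'.
  have -> : B :\: (t |: A) = (B :\ t) :\: A.
    by apply/setP => z; rewrite !inE; case: (z == t); case: (z \in A).
  by rewrite -addrA addrC.
by rewrite E1 E2 cardsU1 tA exprS !addrA -mulrA mulN1r mulrBr.
Qed.

End Degree.

(** * Alternating polynomials *)

(** Sorted, the values increase strictly, so the entry at position [i] is at least [i]. If the sums
    agree, every such inequality is an equality and the values are exactly those below [p]. *)
Lemma injective_nat_sum p (a : 'I_p -> nat) : injective a ->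
  (\sum_(i < p) i <= \sum_i a i)%N /\
  ((\sum_i a i <= \sum_(i < p) i)%N -> exists s : 'S_p, forall i, a i = s i).
Proof.
move=> a_inj; set t := sort leq [seq a i | i <- enum 'I_p].
have t_perm : perm_eq t [seq a i | i <- enum 'I_p] by rewrite perm_sort.
have size_t : size t = p by rewrite size_sort size_map size_enum_ord.
have t_sorted : sorted ltn t.
  rewrite ltn_sorted_uniq_leq sort_sorted ?andbT; last exact: leq_total.
  by rewrite sort_uniq map_inj_uniq ?enum_uniq.
have le_nth i : (i < p)%N -> (i <= nth 0 t i)%N.
  elim: i => // i IH lt_ip; apply: leq_ltn_trans (IH (ltnW lt_ip)) _.
  by apply: (sorted_ltn_nth ltn_trans); rewrite ?inE ?size_t // ltnW.
have sum_t : (\sum_i a i = \sum_(i < p) nth 0 t i)%N.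
  rewrite -(big_enum _ _ _ a) /= -(big_map a xpredT id) -(perm_big _ t_perm) /=.
  by rewrite (big_nth 0%N) size_t big_mkord.
have le_sum : (\sum_(i < p) i <= \sum_(i < p) nth 0 t i)%N.
  by apply: leq_sum => i _; apply: le_nth.
rewrite sum_t; split=> // ge_sum.
have nth_t (i : 'I_p) : nth 0%N t i = i.
  have := @leqif_sum _ xpredT (fun i : 'I_p => i == nth 0%N t i :> nat)
    (fun i : 'I_p => i : nat) (fun i : 'I_p => nth 0%N t i).
  case=> [j _|_]; first exact: leqif_eq (le_nth _ (ltn_ord j)).
  rewrite eqn_leq le_sum ge_sum => /esym/forallP/(_ i)/=/eqP E.
  by rewrite -E.
have a_lt i : (a i < p)%N.
  have : a i \in t by rewrite (perm_mem t_perm) map_f ?mem_enum.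
  case/(nthP 0%N) => j; rewrite size_t => lt_jp <-.
  by rewrite (nth_t (Ordinal lt_jp)).
have s_inj : injective (fun i => Ordinal (a_lt i)).
  by move=> i j [] /a_inj.
by exists (perm s_inj) => i; rewrite permE.
Qed.

Definition vandermonde (K : comNzRingType) (n : nat) (x : 'rV[K]_n) : K :=
  \det (Vandermonde n x).

Section GeneralizedVandermonde.

Variable K : comNzRingType.

(** A repeated exponent gives two equal rows. Distinct exponents with so small a sum are a
    permutation of [0, .., p - 1], which only contributes a sign. *)
Lemma det_powers p (a : 'I_p -> nat) : (\sum_i a i <= \sum_(i < p) i)%N ->
  exists c : K, forall x : 'rV[K]_p,
    \det (\matrix_(i, j) x 0 j ^+ a i) = c * vandermonde x.
Proof.
move=> le_a; case: (boolP (injectiveb a)) => [/injectiveP a_inj|].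
  have [_ /(_ le_a) [s a_s]] := injective_nat_sum a_inj.
  exists ((-1) ^+ s) => x; rewrite -det_perm -det_mulmx; congr (\det _).
  by rewrite -row_permE; apply/matrixP => i j; rewrite !mxE a_s.
move=> /injectivePn[i [j neq_ij a_ij]]; exists 0 => x; rewrite mul0r.
by apply: (determinant_alternate neq_ij) => k; rewrite !mxE a_ij.
Qed.

Lemma det_powers_small p (a : 'I_p -> nat) (x : 'rV[K]_p) :
  (\sum_i a i < \sum_(i < p) i)%N -> \det (\matrix_(i, j) x 0 j ^+ a i) = 0.
Proof.
move=> lt_a; have /injectivePn[i [j neq_ij a_ij]] : ~~ injectiveb a.
  apply/negP => /injectiveP/injective_nat_sum[+ _].
  by rewrite leqNgt lt_a.
by apply: (determinant_alternate neq_ij) => k; rewrite !mxE a_ij.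
Qed.

Variables p q : nat.
Implicit Types (f : 'rV[K]_(p + q) -> K) (x : 'rV[K]_(p + q)).

Definition block_perm (s : 'S_p) (t : 'S_q) x : 'rV[K]_(p + q) :=
  row_mx (col_perm s (lsubmx x)) (col_perm t (rsubmx x)).

Definition block_vandermonde x : K :=
  vandermonde (lsubmx x) * vandermonde (rsubmx x).

Definition alternate f x : K :=
  \sum_(s : 'S_p) \sum_(t : 'S_q) (-1) ^+ s * (-1) ^+ t * f (block_perm s t x).

Lemma block_perm_l s t x i : block_perm s t x 0 (lshift q i) = x 0 (lshift q (s i)).
Proof. by rewrite /block_perm row_mxEl !mxE. Qed.

Lemma block_perm_r s t x j : block_perm s t x 0 (rshift p j) = x 0 (rshift p (t j)).
Proof. by rewrite /block_perm row_mxEr !mxE. Qed.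

Lemma alternate_monomial (e : 'I_(p + q) -> nat) x :
  alternate (fun y => \prod_k y 0 k ^+ e k) x =
    \det (\matrix_(i, j) lsubmx x 0 j ^+ e (lshift q i)) *
    \det (\matrix_(i, j) rsubmx x 0 j ^+ e (rshift p i)).
Proof.
rewrite /alternate /determinant big_distrlr /=; apply: eq_bigr => s _.
apply: eq_bigr => t _; rewrite big_split_ord /= [RHS]mulrACA; congr (_ * (_ * _)).
  by apply: eq_bigr => i _; rewrite block_perm_l !mxE.
by apply: eq_bigr => i _; rewrite block_perm_r !mxE.
Qed.

(** The antisymmetrized monomial is a product of two determinants of powers. If one block has
    exponent sum below its minimum, that determinant is zero; otherwise both sums are minimal and
    both determinants are multiples of Vandermonde determinants. *)
Lemma alternate_monomial_small (e : 'I_(p + q) -> nat) :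
    (\sum_k e k <= \sum_(i < p) i + \sum_(i < q) i)%N ->
  exists c, forall x,
    alternate (fun y => \prod_k y 0 k ^+ e k) x = c * block_vandermonde x.
Proof.
rewrite big_split_ord /= => le_e.
have [lt_p|ge_p] :=
    ltnP (\sum_(i < p) e (lshift q i))%N (\sum_(i < p) i)%N.
  by exists 0 => x; rewrite alternate_monomial det_powers_small // !mul0r.
have [lt_q|ge_q] :=
    ltnP (\sum_(i < q) e (rshift p i))%N (\sum_(i < q) i)%N.
  exists 0 => x; rewrite alternate_monomial [X in _ * X]det_powers_small //.
  by rewrite mulr0 mul0r.
rewrite /= in ge_p ge_q.
have [|c Hc] := @det_powers p (fun i => e (lshift q i)).
  by rewrite /=; lia.
have [|d Hd] := @det_powers q (fun i => e (rshift p i)); first by rewrite /=; lia.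
by exists (c * d) => x; rewrite alternate_monomial Hc Hd mulrACA.
Qed.

Lemma alternate_degree_lt d f :
    degree_lt d f -> (d <= (\sum_(i < p) i + \sum_(i < q) i).+1)%N ->
  exists c, forall x, alternate f x = c * block_vandermonde x.
Proof.
(* The induction peels off one coordinate at a time, and a multiplication by [x_i] does not commute
   with antisymmetrization. The peeled coordinates are therefore collected in a monomial factor with
   exponents [e]. *)
move=> df; suff gen (e : 'I_(p + q) -> nat) :
    (d + \sum_k e k <= (\sum_(i < p) i + \sum_(i < q) i).+1)%N ->
  exists c, forall x,
    alternate (fun y => f y * \prod_k y 0 k ^+ e k) x = c * block_vandermonde x.
  move=> le_d; have [|c Hc] := gen (fun=> 0%N); first by rewrite big1 ?addn0.
  exists c => x; rewrite -Hc; apply: eq_bigr => s _; apply: eq_bigr => t _.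
  by rewrite big1 ?mulr1.
elim: df e => {d f}.
- move=> d e _; exists 0 => x; rewrite mul0r /alternate.
  by rewrite big1 // => s _; rewrite big1 // => t _; rewrite mul0r mulr0.
- move=> d c e le_e; have [|c' Hc'] := @alternate_monomial_small e; first by lia.
  exists (c * c') => x; rewrite -mulrA -Hc' /alternate big_distrr /=.
  apply: eq_bigr => s _; rewrite big_distrr /=; apply: eq_bigr => t _.
  by rewrite mulrCA.
- move=> d i f _ IH e le_e.
  have [|c Hc] := IH (fun k => (k == i) + e k)%N.
    rewrite big_split /= (bigD1 i) //= eqxx big1; first by rewrite addnA addn1.
    by move=> k /negbTE ->.
  exists c => x; rewrite -Hc; apply: eq_bigr => s _; apply: eq_bigr => t _.
  rewrite [in RHS](eq_bigr (fun k => block_perm s t x 0 k ^+ (k == i) *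
    block_perm s t x 0 k ^+ e k)); last by move=> k _; rewrite /= exprD.
  rewrite big_split /= [X in _ = _ * (_ * (X * _))](bigD1 i) //= eqxx expr1.
  rewrite [X in _ = _ * (_ * (_ * X * _))]big1 ?mulr1; last first.
    by move=> k /negbTE ->.
  by congr (_ * _); rewrite -mulrA mulrCA.
- move=> d f g _ IHf _ IHg e le_e; have [c Hc] := IHf e le_e.
  have [c' Hc'] := IHg e le_e; exists (c + c') => x.
  rewrite mulrDl -Hc -Hc' /alternate -big_split; apply: eq_bigr => s _.
  by rewrite -big_split /=; apply: eq_bigr => t _; rewrite mulrDl mulrDr.
- move=> d f g fg _ IH e /IH[c Hc]; exists c => x; rewrite -Hc.
  by apply: eq_bigr => s _; apply: eq_bigr => t _; rewrite fg.
Qed.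

End GeneralizedVandermonde.

(** * Alternating shifts of the Vandermonde polynomial *)

Section Proportionality.

Variables (K : numFieldType) (p q : nat).
Implicit Types (x : 'rV[K]_(p + q)) (s : 'S_p) (t : 'S_q).

(** Half roots, because [2 rho(A) - rho_n] is the sum of half the roots in [A] minus half the
    remaining ones. *)
Definition cross_half_root (ij : 'I_p * 'I_q) : 'rV[K]_(p + q) :=
  2^-1 *: (delta_mx 0 (lshift q ij.1) + delta_mx 0 (rshift p ij.2)).

Definition alternating_vandermonde : 'rV[K]_(p + q) -> K :=
  alternating_shift cross_half_root [set: 'I_p * 'I_q] (@vandermonde K (p + q)).

Lemma degree_lt_vandermonde n :
  degree_lt (\sum_(i < n) i).+1 (@vandermonde K n).
Proof.
apply: (degree_lt_ext (f := fun x : 'rV[K]_n => \sum_(s : 'S_n)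
    (-1) ^+ s * \prod_(i < n) x 0 (s i) ^+ i)) => [x|].
  apply: eq_bigr => s _; congr (_ * _); apply: eq_bigr => i _.
  by rewrite mxE.
apply: degree_lt_sum => s _; apply: degree_lt_scale.
exact: (@degree_lt_monomial K n _ (index_enum 'I_n) s (fun i => i : nat)).
Qed.

Lemma sum_ord_add :
  (\sum_(i < p + q) i = \sum_(i < p) i + \sum_(i < q) i + p * q)%N.
Proof.
rewrite big_split_ord /= -addnA; congr (_ + _)%N.
by rewrite big_split /= sum_nat_const card_ord mulnC addnC.
Qed.

(** The inverses occur because [col_perm s] is right multiplication by [perm_mx s^-1]. *)
Definition block_perm_mx s t : 'M[K]_(p + q) :=
  block_mx (perm_mx s^-1) 0 0 (perm_mx t^-1).

Lemma block_permE s t x : block_perm s t x = x *m block_perm_mx s t.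
Proof.
rewrite /block_perm /block_perm_mx !col_permE -[in RHS](hsubmxK x) mul_row_block.
by rewrite !mulmx0 addr0 add0r.
Qed.

Lemma vandermonde_block_perm s t x :
  vandermonde (block_perm s t x) = (-1) ^+ s * (-1) ^+ t * vandermonde x.
Proof.
have -> : vandermonde (block_perm s t x) =
    \det (Vandermonde (p + q) x *m block_perm_mx s t).
  congr (\det _); apply/row_matrixP => i; rewrite row_mul -block_permE.
  apply/rowP => k; case: (split_ordP k) => j ->; rewrite 2!mxE.
    by rewrite !block_perm_l !mxE.
  by rewrite !block_perm_r !mxE.
by rewrite det_mulmx det_ublock !det_perm !odd_permV mulrC.
Qed.

Lemma cross_half_root_block_perm s t ij :
  block_perm s t (cross_half_root ij) = cross_half_root (s^-1 ij.1, t^-1 ij.2)%g.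
Proof.
apply/rowP => k; case: (split_ordP k) => j ->.
  rewrite block_perm_l !mxE /= !(inj_eq (@lshift_inj _ _)).
  by rewrite !eq_lrshift /= -(inj_eq (@perm_inj _ s) j) permKV.
rewrite block_perm_r !mxE /= !(inj_eq (@rshift_inj _ _)).
by rewrite !eq_rlshift /= -(inj_eq (@perm_inj _ t) j) permKV.
Qed.

(** The product group permutes the cross half roots, so the sum over subsets can be reindexed by
    their images; the sign comes from the Vandermonde determinant alone. *)
Lemma alternating_vandermonde_block_perm s t x :
  alternating_vandermonde (block_perm s t x) =
    (-1) ^+ s * (-1) ^+ t * alternating_vandermonde x.
Proof.
pose g ij : 'I_p * 'I_q := ((s^-1)%g ij.1, (t^-1)%g ij.2).
pose g' ij : 'I_p * 'I_q := (s ij.1, t ij.2).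
have gK : cancel g g' by case=> i j; rewrite /g /g' /= !permKV.
have g'K : cancel g' g by case=> i j; rewrite /g /g' /= !permK.
have g_inj := can_inj gK.
rewrite /alternating_vandermonde /alternating_shift powersetT.
rewrite (reindex (fun A : {set _} => g @: A)) /=; last first.
  exists (fun A : {set _} => g' @: A) => A _; rewrite -imset_comp.
    by rewrite (eq_imset (g := id)) ?imset_id.
  by rewrite (eq_imset (g := id)) ?imset_id.
under eq_bigl => A do rewrite inE.
under [in RHS]eq_bigl => A do rewrite inE.
rewrite big_distrr; apply: eq_bigr => A _ /=.
rewrite card_imset // mulrCA; congr (_ * _).
rewrite -vandermonde_block_perm; congr vandermonde.
rewrite [in RHS]block_permE mulmxDl -block_permE; congr (_ + _).
rewrite /signed_sum mulmxBl !mulmx_suml.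
rewrite !setTD; have -> : ~: (g @: A) = g @: (~: A).
  apply/setP => ij; rewrite -(g'K ij) !(mem_imset _ _ g_inj) inE.
  by rewrite (mem_imset _ _ g_inj) inE.
rewrite !big_imset /=; try by move=> ? ? _ _ /g_inj.
by congr (_ - _); apply: eq_bigr => ij _;
  rewrite -block_permE cross_half_root_block_perm.
Qed.

(** The [p * q] differences bring the degree down to that of the block Vandermonde polynomial, where
    antisymmetrization leaves only its multiples. Antisymmetrizing a function that is already
    alternating multiplies it by [p! q!], which is invertible. *)
Lemma alternating_vandermonde_propto :
  exists c, forall x, alternating_vandermonde x = c * block_vandermonde x.
Proof.
have dF : degree_lt _ alternating_vandermonde := degree_lt_alternating_shift
  cross_half_root [set: 'I_p * 'I_q] (@degree_lt_vandermonde (p + q)).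
move: dF; rewrite cardsT card_prod !card_ord sum_ord_add => dF.
have [|c Hc] := alternate_degree_lt dF; first by rewrite leq_subLR addnS addnC.
have nz : (p`! * q`!)%:R != 0 :> K by rewrite pnatr_eq0 -lt0n muln_gt0 !fact_gt0.
exists ((p`! * q`!)%:R^-1 * c) => x; rewrite -mulrA -Hc.
apply: (mulfI nz); rewrite mulVKf // /alternate.
under eq_bigr => s _ do under eq_bigr => t _ do
  rewrite alternating_vandermonde_block_perm mulrA mulrACA -!expr2 !sqrr_sign !mul1r.
rewrite !sumr_const -mulrnA.
by rewrite -[RHS]mulr_natl !card_Sn mulnC.
Qed.

End Proportionality.

(** * Signed measures and the constant *)

(** Linear independence of monomials: the [m i] may repeat, but grouped by exponent their
    coefficients sum to zero. Hence [f] may be any function of the exponent. *)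
Lemma sum_monomials_eq0 (K : comNzRingType) (n : nat) (I : finType)
    (a : I -> K) (m : I -> 'X_{1..n}) (f : 'X_{1..n} -> K) :
  \sum_i a i *: 'X_[m i] = 0 :> {mpoly K[n]} -> \sum_i a i * f (m i) = 0.
Proof.
move=> am0; pose U := undup [seq m i | i <- enum I].
have mU i : m i \in U by rewrite mem_undup map_f ?mem_enum.
rewrite (eq_bigr (fun i => \sum_(u <- U) (a i * (m i == u)%:R) * f u)); last first.
  move=> i _; rewrite (bigD1_seq (m i)) ?undup_uniq //= eqxx mulr1 big1 ?addr0 //.
  by move=> u /negbTE; rewrite eq_sym => ->; rewrite mulr0 mul0r.
rewrite exchange_big big1 //= => u _; rewrite -big_distrl /=.
have /(congr1 (mcoeff u)) := am0; rewrite mcoeff0 linear_sum /= => E.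
rewrite (eq_bigr (fun i => (a i *: 'X_[m i])@_u)) ?E ?mul0r // => i _.
by rewrite mcoeffZ mcoeffX.
Qed.

(** * Counting permutations by the preimage of a set *)

Section SignedPermutations.

Variable n : nat.

(** List each set followed by its complement, and match the two lists position by position. *)
Lemma exists_perm_imset (S S' : {set 'I_n}) :
  #|S| = #|S'| -> exists s : 'S_n, s @: S = S'.
Proof.
move=> eq_card; pose L (A : {set 'I_n}) := enum A ++ enum (~: A).
have L_perm (A : {set 'I_n}) : perm_eq (L A) (enum 'I_n).
  apply: uniq_perm; rewrite ?enum_uniq // /L.
    rewrite cat_uniq !enum_uniq andbT /=; apply/hasPn => i.
    by rewrite !mem_enum inE.
  by move=> i; rewrite mem_cat !mem_enum !inE orbN.
have sizeL A : size (L A) = n by rewrite (perm_size (L_perm A)) size_enum_ord.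
have memL A i : i \in L A by rewrite (perm_mem (L_perm A)) mem_enum.
have uniqL A : uniq (L A) by rewrite (perm_uniq (L_perm A)) enum_uniq.
pose f i := nth i (L S') (index i (L S)).
have lt_index i : (index i (L S) < size (L S'))%N.
  by rewrite (sizeL S') -[X in (_ < X)%N](sizeL S) index_mem.
have f_inj : injective f.
  move=> i j; rewrite /f (set_nth_default i) // => /eqP.
  by rewrite nth_uniq // => /eqP /index_inj; apply.
exists (perm f_inj); apply/eqP; rewrite eqEcard.
rewrite card_imset ?eq_card ?leqnn ?andbT //; last exact: perm_inj.
apply/subsetP => _ /imsetP[i iS ->]; rewrite permE /f.
have iE : i \in enum S by rewrite mem_enum.
rewrite /L index_cat iE nth_cat -cardE -eq_card cardE index_mem iE.
by rewrite -(mem_enum S'); apply: mem_nth; rewrite -cardE -eq_card cardE index_mem.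
Qed.

(** The map sending [s] to the preimage of [B] has fibres of equal size over all sets of cardinality
    [#|B|]; that size is [n!] divided by the number of such sets. *)
Lemma sum_perm_preimset (K : comNzRingType) (g : {set 'I_n} -> K) (B : {set 'I_n}) :
  \sum_(s : 'S_n) g (s @^-1: B) =
    ((#|B|)`! * (n - #|B|)`!)%:R * \sum_(S : {set 'I_n} | #|S| == #|B|) g S.
Proof.
pose N (S : {set 'I_n}) := #|[set s : 'S_n | s @^-1: B == S]|.
have card_pre (s : 'S_n) : #|s @^-1: B| = #|B|.
  by rewrite on_card_preimset //; apply: onW_bij; apply: injF_bij; apply: perm_inj.
(* Left multiplication by a permutation [r] taking [B] to [S] carries the fibre over [S] to the
   fibre over [B]. *)
have N_const (S : {set 'I_n}) : #|S| = #|B| -> N S = N B.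
  case/esym/exists_perm_imset => r rB.
  rewrite /N -[RHS](card_imset _ (mulgI r^-1%g)); apply: eq_card => s.
  rewrite !inE; apply/eqP/imsetP.
    move=> sB; exists (r * s)%g; last by rewrite mulKg.
    rewrite inE; apply/eqP/setP => i; rewrite !inE permM.
    have /setP/(_ (r i)) := sB; rewrite inE => ->.
    by rewrite -rB (mem_imset _ _ (@perm_inj _ r)).
  case=> s'; rewrite inE => /eqP s'B ->; apply/setP => i; rewrite !inE permM.
  have /setP/(_ (r^-1 i)%g) := s'B; rewrite inE => ->.
  by rewrite -rB -{2}(permKV r i) (mem_imset _ _ (@perm_inj _ r)).
have le_Bn : (#|B| <= n)%N by rewrite -[n in (_ <= n)%N]card_ord max_card.
have NB : N B = ((#|B|)`! * (n - #|B|)`!)%N.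
  have : (n`! = \sum_(S : {set 'I_n} | #|S| == #|B|) N B)%N.
    rewrite -card_Sn -[LHS]sum1_card.
    rewrite (partition_big (fun s : 'S_n => s @^-1: B)
      (fun S => #|S| == #|B|)) /= => [|s _]; last by rewrite card_pre.
    by apply: eq_bigr => S /eqP cS; rewrite -(N_const S) // sum1dep_card.
  rewrite sum_nat_const -cardsE card_draws card_ord -(bin_fact le_Bn) => /eqP.
  by rewrite eqn_pmul2l ?bin_gt0 // => /eqP <-.
rewrite (partition_big (fun s : 'S_n => s @^-1: B) (fun S => #|S| == #|B|)) /=;
  last by move=> s _; rewrite card_pre.
rewrite big_distrr; apply: eq_bigr => S /eqP cS.
rewrite (eq_bigr (fun=> g S)) => [|s /eqP-> //].
by rewrite sumr_const -NB -(N_const S) // /N cardsE /= mulr_natl.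
Qed.

End SignedPermutations.

(** Consecutive factors of the generating product multiply to [1 - X^2]; the two sides are the
    coefficient of [X^(2s)] in [(1 - X^2)^m]. *)
Lemma elementary_symmetric_alternating (K : idomainType) (m s : nat) :
  \sum_(S : {set 'I_m.*2} | #|S| == s.*2) \prod_(k in S) (-1) ^+ (k : nat) =
    (-1) ^+ s * ('C(m, s))%:R :> K.
Proof.
have prod2 : \prod_(k < m.*2) (1 + (-1) ^+ k *: 'X) = (1 - 'X ^+ 2) ^+ m :> {poly K}.
  elim: m => [|m IH]; first by rewrite big_ord0 expr0.
  rewrite doubleS !big_ord_recr /= IH (exprSr _ m) -mulrA; congr (_ * _).
  have -> : (-1) ^+ m.*2.+1 = -1 :> K by rewrite exprS -signr_odd odd_double mulr1.
  by rewrite -signr_odd odd_double scale1r scaleN1r; ring.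
have /(congr1 (fun P : {poly K} => P`_s.*2)) := prod2.
have -> : \prod_(k < m.*2) (1 + (-1) ^+ k *: 'X) =
    \sum_(S : {set 'I_m.*2}) (\prod_(k in S) (-1) ^+ (k : nat)) *: 'X^#|S| :> {poly K}.
  under eq_bigr => k _ do rewrite addrC.
  rewrite bigA_distr; apply: eq_bigr => S _.
  by rewrite -big_mkcond /= scaler_prod prodr_const.
rewrite coef_sum exprBn coef_sum => coef_eq.
rewrite (eq_bigr (fun S : {set 'I_m.*2} =>
    if #|S| == s.*2 then \prod_(k in S) (-1) ^+ (k : nat) else 0 : K)) in coef_eq; last first.
  by move=> S _; rewrite coefZ coefXn eq_sym; case: eqP; rewrite (mulr1, mulr0).
rewrite big_mkcond coef_eq.
have termE (i : nat) : (((-1) ^+ i * 1 ^+ (m - i) * 'X^2 ^+ i *+ 'C(m, i)) : {poly K})`_s.*2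
    = if i == s then (-1) ^+ s * ('C(m, s))%:R else 0.
  rewrite expr1n mulr1 -exprM coefMn -signr_odd.
  have -> : (-1) ^+ odd i = ((-1) ^+ odd i)%:P :> {poly K}.
    by rewrite rmorphXn /= rmorphN1.
  rewrite coefCM coefXn mul2n (inj_eq double_inj) eq_sym.
  by case: eqP => [->|_]; rewrite ?mulr0 ?mul0rn // mulr1 signr_odd mulr_natr.
under eq_bigr => i _ do rewrite termE.
have [le_sm|lt_ms] := leqP s m.
  rewrite (bigD1 (Ordinal (le_sm : (s < m.+1)%N))) //= eqxx big1 ?addr0 // => i.
  by rewrite -val_eqE /= => /negbTE ->.
by rewrite bin_small // mulr0 big1 // => i _; case: eqP.
Qed.

(** * Symmetries and block factorization of the Vandermonde determinant *)

Section VandermondeTheory.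

Variable K : comNzRingType.

Lemma vandermondeE n (x : 'rV[K]_n) :
  vandermonde x = \sum_(s : 'S_n) (-1) ^+ s * \prod_i x 0 (s i) ^+ i.
Proof.
by apply: eq_bigr => s _; congr (_ * _); apply: eq_bigr => i _; rewrite mxE.
Qed.

Lemma vandermonde_trE n (x : 'rV[K]_n) :
  vandermonde x = \sum_(s : 'S_n) (-1) ^+ s * \prod_i x 0 i ^+ s i.
Proof.
rewrite /vandermonde -det_tr.
by apply: eq_bigr => s _; congr (_ * _); apply: eq_bigr => i _; rewrite !mxE.
Qed.

Lemma vandermonde_perm n (s : 'S_n) (x : 'rV[K]_n) :
  vandermonde (col_perm s x) = (-1) ^+ s * vandermonde x.
Proof.
rewrite /vandermonde -(odd_permV s) -det_perm mulrC -det_mulmx -col_permE.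
by congr (\det _); apply/matrixP => i j; rewrite !mxE.
Qed.

Lemma vandermonde_translate n (u : K) (x : 'rV[K]_n) :
  vandermonde (x + const_mx u) = vandermonde x.
Proof.
rewrite /vandermonde !det_Vandermonde; apply: eq_bigr => i _.
by apply: eq_bigr => j _; rewrite !mxE; ring.
Qed.

Lemma vandermondeN n (x : 'rV[K]_n) :
  vandermonde (- x) = (-1) ^+ (\sum_(i < n) i) * vandermonde x.
Proof.
rewrite !vandermondeE big_distrr /=; apply: eq_bigr => s _.
rewrite mulrCA; congr (_ * _); rewrite expr_sum -big_split /=.
by apply: eq_bigr => i _; rewrite mxE [LHS]exprNn.
Qed.

(** The pairs [i < j] of indices lie inside the first block, inside the second, or across the
    two. *)
Lemma vandermonde_block p q (x : 'rV[K]_(p + q)) :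
  vandermonde x = block_vandermonde x *
    \prod_(ij : 'I_p * 'I_q) (x 0 (rshift p ij.2) - x 0 (lshift q ij.1)).
Proof.
rewrite /block_vandermonde /vandermonde !det_Vandermonde big_split_ord /=.
rewrite [RHS]mulrAC; congr (_ * _); last first.
  apply: eq_bigr => i _; rewrite big_split_ord /= big1 ?mul1r.
    by apply: eq_big => [j|j _]; rewrite ?ltn_add2l ?mxE.
  by move=> j; rewrite ltnNge (leq_trans (ltnW (ltn_ord j)) (leq_addr _ _)).
rewrite -(pair_bigA _ (fun i j => x 0 (rshift p j) - x 0 (lshift q i))) /=.
rewrite -big_split; apply: eq_bigr => i _ /=; rewrite big_split_ord /=.
congr (_ * _); first by apply: eq_bigr => j _; rewrite !mxE.
by apply: eq_bigl => j; rewrite (leq_trans (ltn_ord i) (leq_addr _ _)).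
Qed.

Lemma block_vandermonde_oppE p q (x : 'rV[K]_(p + q)) :
  block_vandermonde (- x) = vandermonde (- \row_k x 0 (lshift q k)) *
    vandermonde (- \row_k x 0 (rshift p k)).
Proof.
by congr (_ * _); congr vandermonde; apply/rowP => k; rewrite !mxE.
Qed.

Lemma block_vandermondeN p q (x : 'rV[K]_(p + q)) :
  block_vandermonde (- x) =
    (-1) ^+ (\sum_(i < p) i + \sum_(i < q) i) * block_vandermonde x.
Proof.
rewrite /block_vandermonde exprD mulrACA -!vandermondeN.
by congr (_ * _); congr vandermonde; apply/rowP => k; rewrite !mxE.
Qed.

End VandermondeTheory.

(** Up to translation this is minus the half sum of the roots [eps_i - eps_j], [i < j], so its
    Vandermonde determinant is the denominator of the Weyl dimension polynomial. *)
Definition iota_row (K : comNzRingType) (n : nat) : 'rV[K]_n := \row_i (i : nat)%:R.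

Lemma vandermonde_centered (K : numFieldType) n (x : 'rV[K]_n) :
    (forall k : 'I_n, x 0 k = (n%:R - 1) / 2 - (k : nat)%:R) ->
  vandermonde (- x) = vandermonde (iota_row K n).
Proof.
move=> xE; rewrite -(vandermonde_translate (- ((n%:R - 1) / 2)) (iota_row K n)).
by congr vandermonde; apply/rowP => k; rewrite !mxE xE opprB.
Qed.

Lemma vandermonde_iota_neq0 (K : numDomainType) n : vandermonde (iota_row K n) != 0.
Proof.
rewrite /vandermonde det_Vandermonde; apply/prodf_neq0 => i _.
apply/prodf_neq0 => j lt_ij; rewrite !mxE subr_eq0 eqr_nat.
by rewrite neq_ltn lt_ij orbT.
Qed.

(** Two expansions of one polynomial define the same signed measure on exponents, against which any
    [f] can be integrated. *)
Lemma eq_sum_monomials (K : comNzRingType) (n : nat) (I J : finType)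
    (a : I -> K) (m : I -> 'X_{1..n}) (b : J -> K) (m' : J -> 'X_{1..n})
    (f : 'X_{1..n} -> K) :
  \sum_i a i *: 'X_[m i] = \sum_j b j *: 'X_[m' j] :> {mpoly K[n]} ->
  \sum_i a i * f (m i) = \sum_j b j * f (m' j).
Proof.
move=> /eqP; rewrite -subr_eq0 => /eqP E; apply/eqP; rewrite -subr_eq0; apply/eqP.
pose ab (ij : I + J) := match ij with inl i => a i | inr j => - b j end.
pose mm (ij : I + J) := match ij with inl i => m i | inr j => m' j end.
have := @sum_monomials_eq0 K n _ ab mm f; rewrite !big_sumType /=.
rewrite (eq_bigr (fun j => - (b j *: 'X_[m' j]))) => [|j _]; last by rewrite scaleNr.
rewrite sumrN => /(_ E).
rewrite [in X in X -> _](eq_bigr (fun j => - (b j * f (m' j)))) => [|j _].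
  by rewrite sumrN.
by rewrite mulNr.
Qed.

(** * Two expansions of the Vandermonde determinant in independent variables *)

Section SignedMeasures.

Variables (K : comNzRingType) (p q : nat).

(** The exponent of the term of [V_p(X) V_q(Y) prod (Y_j - X_i)] given by the Leibniz terms [s] and
    [t] and by taking [- X_i] at the pairs in [A], [Y_j] at the others. *)
Definition spread_exponent (sta : 'S_p * 'S_q * {set 'I_p * 'I_q}) :
    'X_{1..(p + q)} :=
  [multinom match split k with
            | inl i => (sta.1.1 i + #|[set j | (i, j) \in sta.2]|)%N
            | inr j => (sta.1.2 j + #|[set i | (i, j) \notin sta.2]|)%N
            end | k < p + q].

Lemma prod_if_fst (R : comNzRingType) (A : {set 'I_p * 'I_q}) (x : 'I_p -> R) :
  \prod_ij (if ij \in A then x ij.1 else 1) =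
    \prod_i x i ^+ #|[set j | (i, j) \in A]|.
Proof.
transitivity (\prod_i \prod_j (if (i, j) \in A then x i else 1)).
  by rewrite pair_bigA; apply: eq_bigr => -[].
apply: eq_bigr => i _; rewrite -big_mkcond /= prodr_const.
by congr (_ ^+ _); apply: eq_card => j; rewrite !inE.
Qed.

Lemma prod_if_snd (R : comNzRingType) (A : {set 'I_p * 'I_q}) (y : 'I_q -> R) :
  \prod_ij (if ij \in A then 1 else y ij.2) =
    \prod_j y j ^+ #|[set i | (i, j) \notin A]|.
Proof.
transitivity (\prod_i \prod_j (if (i, j) \in A then 1 else y j)).
  by rewrite pair_bigA; apply: eq_bigr => -[].
rewrite exchange_big; apply: eq_bigr => j _.
rewrite (eq_bigr (fun i => if (i, j) \notin A then y j else 1)) => [|i _];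
  last by case: ifP.
rewrite -big_mkcond /= prodr_const.
by congr (_ ^+ _); apply: eq_card => i; rewrite !inE.
Qed.

(** Both sides are the Vandermonde determinant of the variables: on the left its Leibniz expansion,
    on the right its block factorization multiplied out. *)
Lemma sum_signed_monomials :
  \sum_(s : 'S_(p + q)) (-1) ^+ s *: 'X_[[multinom (s k : nat) | k < p + q]] =
  \sum_(sta : 'S_p * 'S_q * {set 'I_p * 'I_q})
    ((-1) ^+ sta.1.1 * (-1) ^+ sta.1.2 * (-1) ^+ #|sta.2|) *:
      'X_[spread_exponent sta] :> {mpoly K[p + q]}.
Proof.
pose z : 'rV[{mpoly K[p + q]}]_(p + q) := \row_k 'X_k.
have XE (e : 'I_(p + q) -> nat) :
    'X_[[multinom e k | k < p + q]] = \prod_k z 0 k ^+ e k.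
  by rewrite mpolyXE_id; apply: eq_bigr => k _; rewrite mnmE mxE.
have signE (b : nat) (P : {mpoly K[p + q]}) : (-1) ^+ b *: P = (-1) ^+ b * P.
  by rewrite -mul_mpolyC rmorphXn /= rmorphN1.
transitivity (vandermonde z).
  by rewrite vandermonde_trE; apply: eq_bigr => s _; rewrite XE signE.
rewrite vandermonde_block.
rewrite (eq_bigr (fun ij => - z 0 (lshift q ij.1) + z 0 (rshift p ij.2))); last first.
  by move=> ij _; rewrite addrC.
rewrite bigA_distr /block_vandermonde !vandermonde_trE big_distrlr /=.
rewrite pair_bigA big_distrlr /= pair_bigA; apply: eq_bigr => -[[s t] A] _ /=.
rewrite /spread_exponent XE -!scalerA !signE big_split_ord /=.
have -> : \prod_ij (if ij \in A then - z 0 (lshift q ij.1) else z 0 (rshift p ij.2)) =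
    (-1) ^+ #|A| * (\prod_i z 0 (lshift q i) ^+ #|[set j | (i, j) \in A]| *
      \prod_j z 0 (rshift p j) ^+ #|[set i | (i, j) \notin A]|).
  rewrite -prod_if_fst -prod_if_snd -prodr_const [X in X * _]big_mkcond -!big_split.
  by apply: eq_bigr => ij _ /=; case: ifP => _; rewrite ?mulr1 ?mul1r ?mulN1r.
have -> : \prod_(i < p) z 0 (lshift q i) ^+
      match split (lshift q i) with
      | inl i0 => s i0 + #|[set j | (i0, j) \in A]|
      | inr j => t j + #|[set i0 | (i0, j) \notin A]| end =
    \prod_i lsubmx z 0 i ^+ s i * \prod_i z 0 (lshift q i) ^+ #|[set j | (i, j) \in A]|.
  by rewrite -big_split; apply: eq_bigr => i _; rewrite (unsplitK (inl i)) exprD !mxE.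
have -> : \prod_(j < q) z 0 (rshift p j) ^+
      match split (rshift p j) with
      | inl i0 => s i0 + #|[set j | (i0, j) \in A]|
      | inr j => t j + #|[set i0 | (i0, j) \notin A]| end =
    \prod_j rsubmx z 0 j ^+ t j * \prod_j z 0 (rshift p j) ^+ #|[set i | (i, j) \notin A]|.
  by rewrite -big_split; apply: eq_bigr => j _; rewrite (unsplitK (inr j)) exprD !mxE.
set a := (-1) ^+ s; set b := (-1) ^+ t; set c := (-1) ^+ _.
set P1 := \prod_(_ < _) _; set P2 := \prod_(_ < _) _; set P3 := \prod_(_ < _) _.
set P4 := \prod_(_ < _) _.
clearbody a b c P1 P2 P3 P4; ring.
Qed.

End SignedMeasures.

(** The sum is [s (2s - 1)]. *)
Lemma odd_sum_ord_double s : odd (\sum_(i < s.*2) i) = odd s.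
Proof.
elim: s => [|s IH]; first by rewrite big_ord0.
rewrite doubleS !big_ord_recr /= !oddD IH /= odd_double.
by case: (odd s).
Qed.

(** * The constant of proportionality, by evaluation at shifted permutations *)

Section Constant.

Variables (K : numFieldType) (p q : nat).

Definition block_sign : 'rV[K]_(p + q) := row_mx (const_mx 1) (const_mx (- 1)).

(** The offsets [q/2] and [p/2] cancel those in [signed_sum_l] and [signed_sum_r]: the shift of this
    point by [A] is [spread_exponent (s, t, A)] with the second block negated. *)
Definition block_point (s : 'S_p) (t : 'S_q) : 'rV[K]_(p + q) :=
  row_mx (col_perm s (iota_row K p) + const_mx (q%:R / 2))
    (- (col_perm t (iota_row K q) + const_mx (p%:R / 2))).

Lemma sum_fst_eq (A : {set 'I_p * 'I_q}) (i : 'I_p) :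
  \sum_(ij in A) (ij.1 == i)%:R = (#|[set j | (i, j) \in A]|)%:R :> K.
Proof.
rewrite -sum1_card natr_sum big_mkcond /=.
transitivity (\sum_i' \sum_j (if (i', j) \in A then (i' == i)%:R else 0) : K).
  by rewrite pair_bigA; apply: eq_bigr => -[].
rewrite (bigD1 i) //= [X in _ + X]big1 ?addr0 => [|k /negbTE ->].
  by rewrite [RHS]big_mkcond; apply: eq_bigr => j _; rewrite inE eqxx; case: ifP.
by rewrite big1 // => j _; case: ifP.
Qed.

Lemma sum_snd_eq (A : {set 'I_p * 'I_q}) (j : 'I_q) :
  \sum_(ij in A) (ij.2 == j)%:R = (#|[set i | (i, j) \in A]|)%:R :> K.
Proof.
rewrite -sum1_card natr_sum big_mkcond /=.
transitivity (\sum_i \sum_j' (if (i, j') \in A then (j' == j)%:R else 0) : K).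
  by rewrite pair_bigA; apply: eq_bigr => -[].
rewrite [RHS]big_mkcond; apply: eq_bigr => i _; rewrite (bigD1 j) //= inE eqxx.
rewrite [X in _ + X]big1 ?addr0 => [|k /negbTE ->]; by case: ifP.
Qed.

(** Of the [q] pairs with first index [i], those in [A] contribute [1/2] each and the others
    [-1/2]. *)
Lemma signed_sum_l (A : {set 'I_p * 'I_q}) (i : 'I_p) :
  signed_sum (@cross_half_root K p q) setT A 0 (lshift q i) =
    (#|[set j | (i, j) \in A]|)%:R - q%:R / 2.
Proof.
have E (B : {set 'I_p * 'I_q}) :
    (\sum_(ij in B) cross_half_root K ij) 0 (lshift q i) =
      (#|[set j | (i, j) \in B]|)%:R / 2.
  rewrite summxE -sum_fst_eq big_distrl /=; apply: eq_bigr => ij _.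
  by rewrite !mxE /= !(inj_eq (@lshift_inj _ _)) eq_lrshift addr0 mulrC (eq_sym i).
rewrite /signed_sum !mxE !E setTD.
have -> : [set j | (i, j) \in ~: A] = ~: [set j | (i, j) \in A].
  by apply/setP => j; rewrite !inE.
have : (#|[set j | (i, j) \in A]| + #|~: [set j | (i, j) \in A]|)%N = q.
  by rewrite cardsC card_ord.
by move=> /(congr1 (fun k => k%:R : K)) <-; rewrite natrD; field.
Qed.

Lemma signed_sum_r (A : {set 'I_p * 'I_q}) (j : 'I_q) :
  signed_sum (@cross_half_root K p q) setT A 0 (rshift p j) =
    p%:R / 2 - (#|[set i | (i, j) \notin A]|)%:R.
Proof.
have E (B : {set 'I_p * 'I_q}) :
    (\sum_(ij in B) cross_half_root K ij) 0 (rshift p j) =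
      (#|[set i | (i, j) \in B]|)%:R / 2.
  rewrite summxE -sum_snd_eq big_distrl /=; apply: eq_bigr => ij _.
  by rewrite !mxE /= !(inj_eq (@rshift_inj _ _)) eq_rlshift add0r mulrC (eq_sym j).
rewrite /signed_sum !mxE !E setTD.
have -> : [set i | (i, j) \in ~: A] = [set i | (i, j) \notin A].
  by apply/setP => i; rewrite !inE.
have : (#|[set i | (i, j) \in A]| + #|~: [set i | (i, j) \in A]|)%N = p.
  by rewrite cardsC card_ord.
have -> : ~: [set i | (i, j) \in A] = [set i | (i, j) \notin A].
  by apply/setP => i; rewrite !inE.
by move=> /(congr1 (fun k => k%:R : K)) <-; rewrite natrD; field.
Qed.

(** The two expansions of the Vandermonde determinant are integrated against the function [f] that
    negates the second block of an exponent and takes the Vandermonde polynomial there. *)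
Lemma sum_alternating_vandermonde_points :
  \sum_(s : 'S_p) \sum_(t : 'S_q)
      (-1) ^+ s * (-1) ^+ t * alternating_vandermonde (block_point s t) =
    \sum_(s : 'S_(p + q)) (-1) ^+ s *
      vandermonde (\row_k (block_sign 0 k * (s k : nat)%:R)).
Proof.
pose f (m : 'X_{1..(p + q)}) := vandermonde (\row_k (block_sign 0 k * (m k)%:R)).
have := eq_sum_monomials f (sum_signed_monomials K p q) => E.
rewrite (eq_bigr (fun s : 'S_(p + q) => (-1) ^+ s *
   f [multinom (s k : nat) | k < p + q])); last first.
  move=> s _; congr (_ * _); congr vandermonde; apply/rowP => k.
  by rewrite !mxE mnmE.
rewrite E pair_bigA /=.
rewrite -(pair_bigA _ (fun (st : 'S_p * 'S_q) (A : {set 'I_p * 'I_q}) =>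
  (-1) ^+ st.1 * (-1) ^+ st.2 * (-1) ^+ #|A| *
  f (spread_exponent (st, A)))) /=.
apply: eq_bigr => -[s t] _ /=; rewrite big_distrr powersetT /=.
apply: eq_big => [A|A _]; first by rewrite inE.
rewrite [LHS]mulrA; congr (_ * _); congr vandermonde; apply/rowP => k.
case: (split_ordP k) => i ->.
  rewrite [LHS]mxE signed_sum_l [RHS]mxE /block_sign /block_point !row_mxEl !mxE.
  by rewrite mnmE (unsplitK (inl i)) natrD; field.
rewrite [LHS]mxE signed_sum_r [RHS]mxE /block_sign /block_point !row_mxEr !mxE.
by rewrite mnmE (unsplitK (inr i)) natrD; field.
Qed.

(** Expanding the inner determinant over [t] separates the signs of the coordinates from their
    absolute values. The latter give the factor [vandermonde (iota_row K (p + q))]; the sign product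
    depends only on the preimage under [t] of the second block. *)
Lemma sum_vandermonde_signed_perm :
  \sum_(s : 'S_(p + q)) (-1) ^+ s *
      vandermonde (\row_k (block_sign 0 k * (s k : nat)%:R)) =
    (p`! * q`!)%:R *
      (\sum_(S : {set 'I_(p + q)} | #|S| == q) \prod_(k in S) (-1) ^+ (k : nat)) *
      vandermonde (iota_row K (p + q)).
Proof.
transitivity ((\sum_(t : 'S_(p + q)) \prod_k block_sign 0 (t k) ^+ k) *
    vandermonde (iota_row K (p + q))).
  under eq_bigr => s _ do rewrite vandermondeE big_distrr /=.
  rewrite exchange_big big_distrl; apply: eq_bigr => t _ /=.
  (* After this substitution the coordinate at [t k] has absolute value [s k], and the sign of [t]
     cancels. *)
  rewrite (reindex_inj (mulgI t^-1%g)) vandermondeE big_distrr /=.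
  apply: eq_bigr => s _.
  rewrite mulrA; have -> : (-1) ^+ (t^-1 * s)%g * (-1) ^+ t = (-1) ^+ s :> K.
    by rewrite odd_permM odd_permV signr_addb mulrAC -expr2 sqrr_sign mul1r.
  rewrite [RHS]mulrCA; congr (_ * _); rewrite -big_split; apply: eq_bigr => k _ /=.
  by rewrite !mxE permM permK exprMn.
congr (_ * _); pose B := [set rshift p j | j : 'I_q].
have cB : #|B| = q by rewrite card_imset ?card_ord //; apply: rshift_inj.
have := @sum_perm_preimset _ K
  (fun S => \prod_(k in S) (-1) ^+ (k : nat)) B.
rewrite cB addnK mulnC => <-; apply: eq_bigr => t _; rewrite [RHS]big_mkcond.
apply: eq_bigr => k _; rewrite inE; case: (split_ordP (t k)) => i ->.
  rewrite /block_sign row_mxEl mxE expr1n; case: ifP => // /imsetP[j _ /eqP].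
  by rewrite eq_lrshift.
by rewrite /block_sign row_mxEr mxE imset_f.
Qed.

(** At each of the [p! q!] points the block Vandermonde polynomial is its value at the unpermuted
    rows up to the signs of [s] and [t], which cancel, and the sign from negating the second
    block. *)
Lemma alternating_vandermonde_constant (c : K) :
    (forall x : 'rV[K]_(p + q), alternating_vandermonde x = c * block_vandermonde x) ->
  c * (vandermonde (iota_row K p) * vandermonde (iota_row K q)) *
    (-1) ^+ (\sum_(j < q) j) =
  (\sum_(S : {set 'I_(p + q)} | #|S| == q) \prod_(k in S) (-1) ^+ (k : nat)) *
    vandermonde (iota_row K (p + q)).
Proof.
move=> Hc; have nz : (p`! * q`!)%:R != 0 :> K.
  by rewrite pnatr_eq0 -lt0n muln_gt0 !fact_gt0.
apply: (mulfI nz); rewrite [RHS]mulrA -sum_vandermonde_signed_perm.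
rewrite -sum_alternating_vandermonde_points.
rewrite (eq_bigr (fun=> \sum_(t : 'S_q) c *
  (vandermonde (iota_row K p) * vandermonde (iota_row K q)) *
    (-1) ^+ (\sum_(j < q) j))).
  by rewrite !sumr_const -mulrnA !card_Sn mulr_natl mulnC.
move=> s _; apply: eq_bigr => t _; rewrite Hc /block_vandermonde /block_point.
rewrite row_mxKl row_mxKr vandermondeN !vandermonde_translate !vandermonde_perm.
set X := vandermonde _; set Y := vandermonde _; set e := (-1) ^+ (\sum_(j < q) j).
transitivity (((-1) ^+ s) ^+ 2 * ((-1) ^+ t) ^+ 2 * (c * (X * Y) * e)); last first.
  by rewrite !sqrr_sign !mul1r.
move: X Y e ((-1) ^+ s) ((-1) ^+ t) => X Y e a b; ring.
Qed.

End Constant.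

Lemma alternating_vandermonde_even (K : numFieldType) r s
    (p := r.*2) (q := s.*2) (x : 'rV[K]_(p + q)) :
  alternating_vandermonde x =
    ('C(r + s, r))%:R * vandermonde (iota_row K (p + q)) /
      (vandermonde (iota_row K p) * vandermonde (iota_row K q)) *
    block_vandermonde x.
Proof.
have [c Hc] := alternating_vandermonde_propto K p q.
rewrite Hc; congr (_ * _).
have nz : vandermonde (iota_row K p) * vandermonde (iota_row K q) != 0.
  by rewrite mulf_neq0 ?vandermonde_iota_neq0.
apply: (mulIf nz); rewrite divfK //.
have := alternating_vandermonde_constant Hc.
rewrite -signr_odd odd_sum_ord_double signr_odd.
have -> : (\sum_(S : {set 'I_(p + q)} | #|S| == q) \prod_(k in S) (-1) ^+ (k : nat)) =
    (-1) ^+ s * ('C(r + s, r))%:R :> K.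
  have := elementary_symmetric_alternating K (r + s) s.
  by rewrite doubleD -(bin_sub (leq_addl r s)) addnK.
(* The sign from negating the second block and the sign of the elementary symmetric function are
   both [(-1)^s]. *)
rewrite -mulrA [_ * (-1) ^+ s]mulrC mulrCA -[in RHS]mulrA.
by apply: mulfI; rewrite signr_eq0.
Qed.

(** * Root data *)

Section FiniteSets.

Lemma big_imfset_fin (R : Type) (idx : R) (op : Monoid.com_law idx) (T : finType)
    (U : choiceType) (key : unit) (f : T -> U) (P : finmempred T) (F : U -> R) :
    {in P &, injective f} ->
  \big[op/idx]_(a <- imfset key f P) F a = \big[op/idx]_(x | x \in P) F (f x).
Proof.
move=> f_inj; rewrite big_imfset // -[RHS]big_filter; apply: perm_big.
apply: uniq_perm; rewrite ?enum_finmem_uniq ?filter_uniq ?index_enum_uniq // => x.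
by rewrite enum_finmemE mem_filter mem_index_enum andbT.
Qed.

Lemma card_imfset_fin (T : finType) (U : choiceType) (key : unit) (f : T -> U)
    (P : finmempred T) :
  {in P &, injective f} -> #|` imfset key f P| = #|[pred x | x \in P]|.
Proof.
move=> f_inj; rewrite card_in_imfset // -sum1_card -sum1_size.
rewrite -[RHS]big_filter; apply: perm_big.
apply: uniq_perm; rewrite ?enum_finmem_uniq ?filter_uniq ?index_enum_uniq // => x.
by rewrite enum_finmemE mem_filter mem_index_enum andbT.
Qed.

(** This turns sums over sets of roots into sums over sets of index pairs. *)
Lemma big_fpowerset_image (R : Type) (idx : R) (op : Monoid.com_law idx)
    (T : finType) (U : choiceType) (f : T -> U) (F : {fset U} -> R) :
    injective f ->
  \big[op/idx]_(A <- fpowerset [fset f x | x : T]%fset) F A =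
    \big[op/idx]_(A : {set T}) F [fset f x | x in A]%fset.
Proof.
move=> f_inj; pose G (A : {set T}) := [fset f x | x in A]%fset.
have memG x A : (f x \in G A) = (x \in A).
  apply/imfsetP/idP => /= [[y yA /f_inj ->] // | xA]; by exists x.
have G_inj : injective G.
  by move=> A B AB; apply/setP => x; rewrite -!memG AB.
rewrite -[RHS](big_map G xpredT F); apply: perm_big; apply: uniq_perm.
- exact: fset_uniq.
- by rewrite map_inj_uniq ?index_enum_uniq.
move=> B; rewrite fpowersetE; apply/idP/mapP => [/fsubsetP sB | [A _ ->]].
  exists [set x | f x \in B]; first exact: mem_index_enum.
  apply/fsetP => y; apply/idP/idP.
    move=> yB; have /imfsetP[x _ yE] := sB y yB.
    by rewrite yE memG inE -yE.
  by case/imfsetP => x /=; rewrite inE => xB ->.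
apply/fsubsetP => y /imfsetP[x _ ->]; exact: in_imfset.
Qed.

End FiniteSets.

(** * Compact and noncompact roots; root systems of type A *)

Section RootSystem.

Variables (R : realType) (n : nat).
Local Notation C := R[i].
Implicit Types (a x : 'rV[C]_n).

Lemma epsE (i k : 'I_n) : eps R i 0 k = (k == i)%:R.
Proof. by rewrite mxE eqxx. Qed.

Lemma formC x y : form x y = form y x :> C.
Proof. by apply: eq_bigr => i _; rewrite mulrC. Qed.

Lemma form_eps x (i : 'I_n) : form x (eps R i) = x 0 i.
Proof.
rewrite /form (bigD1 i) //= epsE eqxx mulr1 big1 ?addr0 // => k /negbTE.
by rewrite epsE => ->; rewrite mulr0.
Qed.

Lemma formDr x y z : form x (y + z) = form x y + form x z :> C.
Proof.
by rewrite /form -big_split; apply: eq_bigr => i _; rewrite mxE mulrDr.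
Qed.

Lemma formNr x y : form x (- y) = - form x y :> C.
Proof.
by rewrite /form -sumrN; apply: eq_bigr => i _; rewrite mxE mulrN.
Qed.

(** This functional tells the two kinds of roots apart: it is 0 on compact roots and 2 or -2 on
    noncompact ones. *)
Definition coord_sum a : C := form (const_mx 1) a.

Lemma coord_sum_sub i j : coord_sum (eps R i - eps R j) = 0.
Proof. by rewrite /coord_sum formDr formNr !form_eps !mxE subrr. Qed.

Lemma coord_sum_add i j : coord_sum (eps R i + eps R j) = 2.
Proof. by rewrite /coord_sum formDr !form_eps !mxE. Qed.

Lemma pos_compactP a : reflect
  (exists i j : 'I_n, (i < j)%N /\ a = eps R i - eps R j) (a \in pos_compact_roots R n).
Proof.
apply: (iffP (imfsetP _ _ _ _)) => [[[i j]] | [i [j [lt_ij ->]]]].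
  by rewrite inE => /= lt_ij ->; exists i, j.
by exists (i, j).
Qed.

Lemma pos_noncompactP a : reflect
  (exists i j : 'I_n, (i < j)%N /\ a = eps R i + eps R j) (a \in pos_noncompact_roots R n).
Proof.
apply: (iffP (imfsetP _ _ _ _)) => [[[i j]] | [i [j [lt_ij ->]]]].
  by rewrite inE => /= lt_ij ->; exists i, j.
by exists (i, j).
Qed.

Lemma coord_sum_compact a : a \in compact_roots R n -> coord_sum a = 0.
Proof.
rewrite /compact_roots inE => /orP[/pos_compactP[i [j [_ ->]]]|].
  exact: coord_sum_sub.
case/imfsetP => b /pos_compactP[i [j [_ ->]]] ->.
by rewrite /coord_sum formNr [form _ _]coord_sum_sub oppr0.
Qed.

Lemma coord_sum_noncompact a : a \in noncompact_roots R n -> coord_sum a != 0.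
Proof.
rewrite /noncompact_roots inE => /orP[/pos_noncompactP[i [j [_ ->]]]|].
  by rewrite coord_sum_add pnatr_eq0.
case/imfsetP => b /pos_noncompactP[i [j [_ ->]]] ->.
by rewrite /coord_sum formNr [form _ _]coord_sum_add oppr_eq0 pnatr_eq0.
Qed.

(** The embedding [f] of indices allows one treatment of the compact roots of the whole algebra and
    of each block of the Levi subalgebra. *)
Definition type_A_roots (m : nat) (f : 'I_m -> 'I_n) : {fset 'rV[C]_n} :=
  [fset eps R (f ij.1) - eps R (f ij.2) | ij : 'I_m * 'I_m & (ij.1 < ij.2)%N]%fset.

Section TypeA.

Variables (m : nat) (f : 'I_m -> 'I_n).
Hypothesis f_inj : injective f.

(** The indices are read off from the coordinates 1 and -1, which differ from each other and from 0
    in characteristic zero. *)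
Lemma type_A_inj : {in [pred ij : 'I_m * 'I_m | (ij.1 < ij.2)%N] &,
  injective (fun ij => eps R (f ij.1) - eps R (f ij.2))}.
Proof.
move=> [i j] [i' j'] /=; rewrite !inE /= => lt_ij lt_ij' /rowP E.
have neq_ij : (f i == f j) = false by rewrite (inj_eq f_inj) -val_eqE /= ltn_eqF.
have := E (f i); have := E (f j); rewrite !mxE eqxx /= neq_ij eq_sym neq_ij.
rewrite !eqxx !(inj_eq f_inj) /= => Ej Ei.
have ii : i = i'.
  apply/eqP; move: Ei; case: (i == i') => //; case: (i == j') => /eqP /=.
    by rewrite subr0 sub0r -subr_eq0 opprK -natrD pnatr_eq0.
  by rewrite subrr subr0 oner_eq0.
have jj : j = j'.
  apply/eqP; move: Ej; rewrite -ii; case: (j == j') => //.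
  case: (j == i) => /eqP /=.
    by rewrite sub0r subr0 eq_sym -subr_eq0 opprK -natrD pnatr_eq0.
  by rewrite subrr sub0r oppr_eq0 oner_eq0.
by rewrite ii jj.
Qed.

Lemma big_type_A (S : Type) (idx : S) (op : Monoid.com_law idx)
    (F : 'rV[C]_n -> S) :
  \big[op/idx]_(a <- type_A_roots f) F a =
    \big[op/idx]_(i < m) \big[op/idx]_(j < m | (i < j)%N) F (eps R (f i) - eps R (f j)).
Proof.
rewrite big_imfset_fin; last exact: type_A_inj.
by rewrite pair_big_dep; apply: eq_bigl => -[i j]; rewrite inE.
Qed.

(** The argument is negated because the root with [i < j] gives [x_i - x_j], whereas the Vandermonde
    factor is [x_j - x_i]. *)
Lemma prod_form_type_A x :
  \prod_(a <- type_A_roots f) form x a = vandermonde (- \row_k x 0 (f k)).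
Proof.
rewrite big_type_A /vandermonde det_Vandermonde; apply: eq_bigr => i _.
by apply: eq_bigr => j _; rewrite formDr formNr !form_eps !mxE opprK addrC.
Qed.

(** The vector indexed by [k] occurs [m - 1 - k] times with a plus sign and [k] times with a minus
    sign. *)
Lemma sum_type_A :
  \sum_(a <- type_A_roots f) a = \sum_(k < m) (m%:R - 1 - (k : nat)%:R *+ 2) *: eps R (f k).
Proof.
rewrite big_type_A.
transitivity (\sum_(i < m) (\sum_(j < m | (i < j)%N) eps R (f i))
  - \sum_(i < m) \sum_(j < m | (i < j)%N) eps R (f j)).
  by rewrite -sumrB; apply: eq_bigr => i _; rewrite -sumrB.
rewrite [X in _ - X](exchange_big_dep xpredT) //= -sumrB; apply: eq_bigr => k _.
rewrite !sumr_const; set u := eps R (f k).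
have -> : #|[pred i : 'I_m | (i < k)%N]| = k.
  rewrite -[RHS]card_ord -sum1_card -[RHS]sum1_card.
  by rewrite (big_ord_widen m (fun=> 1%N) (ltnW (ltn_ord k))).
have : (#|[pred j : 'I_m | (k < j)%N]| + k.+1 = m)%N.
  rewrite -[RHS]card_ord -(cardC [pred j : 'I_m | (k < j)%N]); congr addn.
  rewrite -[LHS]card_ord -sum1_card (big_ord_widen m (fun=> 1%N) (ltn_ord k)) sum1_card.
  by apply: eq_card => j; rewrite !inE -leqNgt ?ltnS.
move=> /(congr1 (fun l => l%:R : C)) cD.
rewrite -(scaler_nat _ u) -(scaler_nat k u) -scalerBl; congr (_ *: _).
by rewrite -cD natrD -natr1; ring.
Qed.

(** The set [B] stands for the roots of the other block, whose sum vanishes on the coordinates of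
    this one. *)
Lemma rho_type_A_coord (k : 'I_m) (A B : {fset 'rV[C]_n}) :
    (\sum_(a <- A) a = \sum_(a <- type_A_roots f) a + \sum_(a <- B) a) ->
    (\sum_(a <- B) a) 0 (f k) = 0 ->
  rho A 0 (f k) = (m%:R - 1) / 2 - (k : nat)%:R.
Proof.
move=> sumA B0; rewrite /rho sumA sum_type_A !mxE B0 addr0 summxE (bigD1 k) //=.
rewrite big1 => [|l neq_lk]; last first.
  by rewrite mxE epsE (inj_eq f_inj) eq_sym (negbTE neq_lk) mulr0.
by rewrite !mxE !eqxx /=; field; rewrite ?pnatr_eq0.
Qed.

End TypeA.

Lemma pos_compact_roots_type_A : pos_compact_roots R n = type_A_roots id.
Proof. by []. Qed.

End RootSystem.

(** * Roots relative to the semisimple element of the real form *)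

Section RealForm.

Variables (R : realType) (p q : nat).
Local Notation C := R[i].
Local Notation V := 'rV[C]_(p + q).
Local Notation h := (h_real_form R (p + q) p).
Implicit Types (a x : V).

Lemma h_l i : h 0 (lshift q i) = 1.
Proof. by rewrite mxE /= ltn_ord. Qed.

Lemma h_r j : h 0 (rshift p j) = -1.
Proof. by rewrite mxE /= ltnNge leq_addr. Qed.

Lemma form_sub_h i j : form (eps R i - eps R j) h = h 0 i - h 0 j.
Proof. by rewrite formC formDr formNr !form_eps. Qed.

Lemma form_add_h i j : form (eps R i + eps R j) h = h 0 i + h 0 j.
Proof. by rewrite formC formDr !form_eps. Qed.

Lemma p1_roots_eq0 : p1_roots h = fset0.
Proof.
apply/fsetP => a; rewrite !inE; apply/negP => /andP[aN /eqP ah].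
have val_h k : h 0 k = 1 \/ h 0 k = -1.
  by case: (split_ordP k) => i ->; rewrite ?h_l ?h_r; [left | right].
have no_odd (b : C) : b \in [:: 2; 0; -2] -> b <> 1 /\ - b <> 1.
  have n21 : (2 : C) != 1 by rewrite (eqr_nat C 2 1).
  have m21 : (- 2 : C) != 1 by rewrite -subr_eq0 -opprD oppr_eq0 natr1 pnatr_eq0.
  have n01 : (0 : C) != 1 by rewrite eq_sym oner_eq0.
  by rewrite !inE => /or3P[] /eqP->; rewrite ?opprK ?oppr0; split; apply/eqP.
have form_in i j : form (eps R i + eps R j) h \in [:: 2; 0; -2].
  rewrite form_add_h !inE; case: (val_h i) => ->; case: (val_h j) => ->;
    by rewrite ?subrr ?addNr -?opprD -?natrD eqxx ?orbT.
case/orP: aN => [/pos_noncompactP[i [j [_ aE]]]|].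
  by have [+ _] := no_odd _ (form_in i j); rewrite -aE.
case/imfsetP => b /pos_noncompactP[i [j [_ bE]]] aE.
have [_] := no_odd _ (form_in i j).
by rewrite -bE -{1}[b]opprK -aE formC formNr formC opprK.
Qed.

Definition cross_roots : {fset V} :=
  [fset (eps R (lshift q ij.1) + eps R (rshift p ij.2))%R | ij : 'I_p * 'I_q]%fset.

Lemma cross_roots_inj :
  injective (fun ij : 'I_p * 'I_q => eps R (lshift q ij.1) + eps R (rshift p ij.2)).
Proof.
move=> [i j] [i' j'] /= /rowP E; have := E (lshift q i); have := E (rshift p j).
rewrite !mxE !eqxx /= !(inj_eq (@lshift_inj _ _)) !(inj_eq (@rshift_inj _ _)).
rewrite !eq_lrshift !eq_rlshift !add0r !addr0.
case: (i =P i') => [->|_]; case: (j =P j') => [-> //|_] //= /eqP;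
  rewrite ?oner_eq0 // => _ /eqP; by rewrite oner_eq0.
Qed.

Lemma ltn_lr (i : 'I_p) (j : 'I_q) : (lshift q i < rshift p j)%N.
Proof. exact: leq_trans (ltn_ord i) (leq_addr _ _). Qed.

Lemma two_neq0 : (2 : C) != 0. Proof. by rewrite pnatr_eq0. Qed.

Lemma in_levi_roots a : (a \in levi_roots h) = (a \in roots R (p + q)) && (form a h == 0).
Proof. by rewrite /levi_roots in_fset inE. Qed.

(** A sum of two coordinates of [h] vanishes only if they lie in different blocks; [i < j] then puts
    [i] in the first. *)
Lemma pos_noncompact_levi_rootsE : pos_noncompact_levi_roots h = cross_roots.
Proof.
apply/fsetP => a; apply/idP/imfsetP => /=.
  rewrite /pos_noncompact_levi_roots /pos_levi_roots.
  rewrite in_fsetI in_fsetI in_levi_roots => /andP[/andP[/andP[_ /eqP ah]]].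
  rewrite /pos_roots in_fsetU => aP /coord_sum_noncompact a1.
  have /pos_noncompactP[i [j [lt_ij aE]]] : a \in pos_noncompact_roots R (p + q).
    case/orP: aP => // /pos_compactP[i [j [_ aE]]].
    by rewrite aE coord_sum_sub eqxx in a1.
  move: ah lt_ij; rewrite aE form_add_h.
  case: (split_ordP i) => i' ->; case: (split_ordP j) => j' ->; rewrite ?h_l ?h_r.
  - by move=> /eqP; rewrite (negbTE two_neq0).
  - by exists (i', j').
  - by rewrite ltnNge ltnW // ltn_lr.
  - by move=> /eqP; rewrite -opprD oppr_eq0 (negbTE two_neq0).
case=> -[i j] _ ->; have aN : eps R (lshift q i) + eps R (rshift p j)
    \in pos_noncompact_roots R (p + q).
  by apply/pos_noncompactP; exists (lshift q i), (rshift p j); rewrite ltn_lr.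
rewrite /pos_noncompact_levi_roots /pos_levi_roots.
rewrite in_fsetI in_fsetI in_levi_roots /roots /noncompact_roots /pos_roots !in_fsetU aN.
by rewrite !orbT form_add_h h_l h_r subrr eqxx.
Qed.

Lemma type_A_roots_pos_compact (m : nat) (f : 'I_m -> 'I_(p + q)) a :
    {homo f : i j / (i < j)%N} ->
  a \in type_A_roots R f -> a \in pos_compact_roots R (p + q).
Proof.
move=> f_homo /imfsetP[[i j] /=]; rewrite inE => /= lt_ij ->.
by apply/pos_compactP; exists (f i), (f j); rewrite f_homo.
Qed.

Lemma pos_compact_levi_rootsE :
  pos_compact_levi_roots h =
    (type_A_roots R (lshift q) `|` type_A_roots R (@rshift p q))%fset.
Proof.
apply/fsetP => a; rewrite in_fsetU; apply/idP/orP.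
  rewrite /pos_compact_levi_roots /pos_levi_roots.
  rewrite in_fsetI in_fsetI in_levi_roots => /andP[/andP[/andP[_ /eqP ah]]].
  rewrite /pos_roots in_fsetU => aP /coord_sum_compact a1.
  have /pos_compactP[i [j [lt_ij aE]]] : a \in pos_compact_roots R (p + q).
    case/orP: aP => // /pos_noncompactP[i [j [_ aE]]].
    by move: a1; rewrite aE coord_sum_add => /eqP; rewrite (negbTE two_neq0).
  move: ah lt_ij; rewrite aE form_sub_h.
  case: (split_ordP i) => i' ->; case: (split_ordP j) => j' ->; rewrite ?h_l ?h_r.
  - by move=> _ lt_ij; left; apply/imfsetP; exists (i', j').
  - by rewrite opprK => /eqP; rewrite (negbTE two_neq0).
  - by rewrite ltnNge ltnW // ltn_lr.
  - by rewrite /= ltn_add2l => _ lt_ij; right; apply/imfsetP; exists (i', j').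
move=> aA; have [aP ah] : a \in pos_compact_roots R (p + q) /\ form a h = 0.
  case: aA => aA; split.
  - by apply: type_A_roots_pos_compact aA => i j.
  - by case/imfsetP: aA => -[i j] _ ->; rewrite form_sub_h !h_l subrr.
  - by apply: type_A_roots_pos_compact aA => i j; rewrite /= ltn_add2l.
  - by case/imfsetP: aA => -[i j] _ ->; rewrite form_sub_h !h_r subrr.
rewrite /pos_compact_levi_roots /pos_levi_roots.
rewrite in_fsetI in_fsetI in_levi_roots /roots /compact_roots /pos_roots !in_fsetU aP.
by rewrite ah eqxx.
Qed.

(** The positive roots with positive value on [h] are the differences across the blocks and the sums
    inside the first block. *)
Lemma odd_num_pos_on : odd (num_pos_on h) = odd (p * q + \sum_(i < p) i).
Proof.
pose g (ij : 'I_p * 'I_q) := eps R (lshift q ij.1) - eps R (rshift p ij.2).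
pose g' (ij : 'I_p * 'I_p) := eps R (lshift q ij.1) + eps R (lshift q ij.2).
pose A := [fset g ij | ij : 'I_p * 'I_q]%fset.
pose B := [fset g' ij | ij : 'I_p * 'I_p & (ij.1 < ij.2)%N]%fset.
have g_inj : injective g.
  (* Changing the sign of the second block turns these differences into the cross roots. *)
  move=> [i j] [i' j'] /= /rowP E; apply: cross_roots_inj; apply/rowP => k /=.
  have := E k; case: (split_ordP k) => k' ->; rewrite !mxE !eqxx /=.
    by rewrite !eq_lrshift !subr0 !addr0.
  by rewrite !eq_rlshift !sub0r !add0r => /oppr_inj.
have g'_inj : {in [pred ij : 'I_p * 'I_p | (ij.1 < ij.2)%N] &, injective g'}.
  move=> [i j] [i' j']; rewrite !inE /= => lt_ij lt_ij' /rowP E.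
  have neq_ij : (i == j) = false by rewrite -val_eqE /= ltn_eqF.
  have neq_ij' : (i' == j') = false by rewrite -val_eqE /= ltn_eqF.
  have := E (lshift q i); have := E (lshift q j).
  rewrite !mxE !eqxx /= !(inj_eq (@lshift_inj _ _)) ?eqxx neq_ij (eq_sym j i) neq_ij.
  rewrite add0r addr0 -!natrD => /eqP; rewrite eqr_nat => Ej /eqP; rewrite eqr_nat => Ei.
  move: Ei Ej; case: (i =P i') => [ii|_].
    case: (j =P j') => [jj|_]; first by rewrite ii jj.
    by rewrite -ii (eq_sym j) neq_ij.
  case: (i =P j') => // ij'; case: (j =P i') => [ji'|_].
    by move: lt_ij'; rewrite -ji' -ij' ltnNge ltnW.
  by rewrite -ij' (eq_sym j) neq_ij.
have posE : [fset a in pos_roots R (p + q) | 0 < form a h]%fset = (A `|` B)%fset.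
  apply/fsetP => a; rewrite in_fset in_fsetU /=; apply/andP/orP.
    case=> aP; case/fsetUP: aP => [/pos_compactP|/pos_noncompactP] [i [j [lt_ij ->]]].
      rewrite form_sub_h; move: lt_ij.
      case: (split_ordP i) => i' ->; case: (split_ordP j) => j' ->; rewrite ?h_l ?h_r.
      - by rewrite subrr ltxx.
      - by move=> _ _; left; apply/imfsetP; exists (i', j').
      - by rewrite ltnNge ltnW // ltn_lr.
      - by rewrite subrr ltxx.
    rewrite form_add_h; move: lt_ij.
    case: (split_ordP i) => i' ->; case: (split_ordP j) => j' ->; rewrite ?h_l ?h_r.
    - by move=> lt_ij _; right; apply/imfsetP; exists (i', j').
    - by rewrite subrr ltxx.
    - by rewrite ltnNge ltnW // ltn_lr.
    - by rewrite -opprD oppr_gt0 lt_gtF // addr_gt0 ?ltr01.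
  case=> /imfsetP[[i j] /=].
    move=> _ ->; split; last by rewrite form_sub_h h_l h_r opprK addr_gt0 ?ltr01.
    apply/fsetUP; left; apply/pos_compactP.
    by exists (lshift q i), (rshift p j); rewrite ltn_lr.
  rewrite inE => /= lt_ij ->; split; last by rewrite form_add_h !h_l addr_gt0 ?ltr01.
  by apply/fsetUP; right; apply/pos_noncompactP; exists (lshift q i), (lshift q j).
have disjAB : (A `&` B = fset0)%fset.
  apply/fsetP => a; rewrite !inE; apply/negP => /andP[/imfsetP[ij _ aE] /imfsetP[ij' _]].
  move=> /(congr1 (@coord_sum R (p + q))); rewrite aE coord_sum_sub coord_sum_add.
  by move=> /eqP; rewrite eq_sym (negbTE two_neq0).
rewrite /num_pos_on posE cardfsU disjAB cardfs0 subn0.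
congr (odd (_ + _)).
  rewrite card_imfset_fin //; last by move=> ? ? _ _; apply: g_inj.
  rewrite -[X in (X * q)%N]card_ord -[X in (_ * X)%N]card_ord -card_prod.
  by apply: eq_card => ij; rewrite !inE.
rewrite card_imfset_fin //.
transitivity (\sum_(i < p) \sum_(j < p | (i < j)%N) 1)%N.
  by rewrite -sum1_card pair_big_dep; apply: eq_bigl => -[i j]; rewrite !inE.
(* The pairs are counted by their larger index [j], which has [j] partners. *)
rewrite (exchange_big_dep xpredT) //=; apply: eq_bigr => j _.
rewrite sum1_card -[RHS]card_ord -[RHS]sum1_card.
by rewrite (big_ord_widen p (fun=> 1%N) (ltnW (ltn_ord j))) sum1_card.
Qed.

End RealForm.

Lemma big_fsetU_disjoint (S : Type) (idx : S) (op : Monoid.com_law idx)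
    (U : choiceType) (A B : {fset U}) (F : U -> S) : (A `&` B = fset0)%fset ->
  \big[op/idx]_(a <- (A `|` B)%fset) F a =
    op (\big[op/idx]_(a <- A) F a) (\big[op/idx]_(a <- B) F a).
Proof.
move=> AB0; rewrite -big_cat; apply: perm_big; apply: uniq_perm.
- exact: fset_uniq.
- rewrite cat_uniq !fset_uniq andbT /=; apply/hasPn => a aB.
  by apply/negP => aA; have := in_fset0 a; rewrite -AB0 in_fsetI aA aB.
by move=> a; rewrite in_fsetU mem_cat.
Qed.

(** * Dimension polynomials as Vandermonde quotients, and the alternating sum *)

Section Assembly.

Variable R : realType.
Local Notation C := R[i].

Lemma P_KE n (x : 'rV[C]_n) :
  P_K x = vandermonde (- x) / vandermonde (iota_row C n).
Proof.
have prodE (y : 'rV[C]_n) :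
    \prod_(a <- pos_compact_roots R n) form y a = vandermonde (- y).
  rewrite pos_compact_roots_type_A (prod_form_type_A (inj_id (A := 'I_n))).
  by congr vandermonde; apply/rowP => k; rewrite !mxE.
have rhoE : vandermonde (- rho (pos_compact_roots R n)) = vandermonde (iota_row C n).
  apply: vandermonde_centered => k.
  apply: (@rho_type_A_coord _ _ _ id _ _ _ fset0) => //.
    by rewrite big_seq_fset0 addr0.
  by rewrite big_seq_fset0 mxE.
by rewrite /P_K /weyl_dim_poly prodf_div !prodE rhoE.
Qed.

Variables p q : nat.
Local Notation h := (h_real_form R (p + q) p).

Lemma type_A_levi_disjoint :
  (type_A_roots R (lshift q) `&` type_A_roots R (@rshift p q) = fset0)%fset.
Proof.
apply/fsetP => a; rewrite in_fsetI in_fset0; apply/negP.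
move=> /andP[/imfsetP[[i j] + ->] /imfsetP[[i' j'] _ /rowP/(_ (lshift q i))]].
rewrite inE /= !mxE !eqxx /= !eq_lrshift !(inj_eq (@lshift_inj _ _)) => lt_ij.
by rewrite -(val_eqE i j) (ltn_eqF lt_ij) !subr0 => /eqP; rewrite oner_eq0.
Qed.

(** The compact Levi roots form two disjoint systems of type A, and the roots of one block do not
    affect the coordinates of the half sum on the other. *)
Lemma P_LKE (x : 'rV[C]_(p + q)) :
  P_LK h x = block_vandermonde (- x) /
    (vandermonde (iota_row C p) * vandermonde (iota_row C q)).
Proof.
have prodE (y : 'rV[C]_(p + q)) :
    \prod_(a <- pos_compact_levi_roots h) form y a = block_vandermonde (- y).
  rewrite pos_compact_levi_rootsE big_fsetU_disjoint ?type_A_levi_disjoint //.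
  rewrite (prod_form_type_A (@lshift_inj p q)) (prod_form_type_A (@rshift_inj p q)).
  by rewrite block_vandermonde_oppE.
have sumE := big_fsetU_disjoint +%R id type_A_levi_disjoint.
have zero_l (k : 'I_p) : (\sum_(a <- type_A_roots R (@rshift p q)) a) 0 (lshift q k) = 0.
  rewrite sum_type_A; last exact: rshift_inj.
  by rewrite summxE big1 // => j _; rewrite mxE epsE eq_lrshift mulr0.
have zero_r (k : 'I_q) : (\sum_(a <- type_A_roots R (lshift q)) a) 0 (@rshift p q k) = 0.
  rewrite sum_type_A; last exact: lshift_inj.
  by rewrite summxE big1 // => j _; rewrite mxE epsE eq_rlshift mulr0.
have rhoE : block_vandermonde (- rho (pos_compact_levi_roots h)) =
    vandermonde (iota_row C p) * vandermonde (iota_row C q).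
  rewrite block_vandermonde_oppE pos_compact_levi_rootsE.
  rewrite !vandermonde_centered // => k; rewrite mxE.
    by apply: (rho_type_A_coord (@rshift_inj p q) (etrans sumE (addrC _ _))).
  by apply: (rho_type_A_coord (@lshift_inj p q) sumE).
by rewrite /P_LK /weyl_dim_poly prodf_div !prodE rhoE.
Qed.

Lemma rho_cross_roots (A : {set 'I_p * 'I_q}) :
  rho [fset (eps R (lshift q ij.1) + eps R (rshift p ij.2))%R | ij in A]%fset =
    \sum_(ij in A) cross_half_root C ij.
Proof.
rewrite /rho big_imfset_fin; last by move=> ? ? _ _; apply: cross_roots_inj.
exact: scaler_sumr.
Qed.

Lemma rho_all_cross_roots :
  rho (cross_roots R p q) = \sum_(ij in [set: 'I_p * 'I_q]) cross_half_root C ij.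
Proof.
rewrite /rho big_imfset_fin; last by move=> ? ? _ _; apply: cross_roots_inj.
rewrite scaler_sumr; apply: eq_bigl => ij; by rewrite !inE.
Qed.

Lemma shift_signed_sum (x : 'rV[C]_(p + q)) (A : {set 'I_p * 'I_q}) :
  x - rho (cross_roots R p q)
    + 2 *: rho [fset (eps R (lshift q ij.1) + eps R (rshift p ij.2))%R | ij in A]%fset
    - 2 *: rho fset0 =
  x + signed_sum (@cross_half_root C p q) setT A.
Proof.
rewrite {3}/rho big_seq_fset0 !scaler0 subr0 rho_cross_roots rho_all_cross_roots.
rewrite /signed_sum -addrA; congr (_ + _).
(* Splitting all pairs into [A] and its complement cancels one of the two copies of the sum over
   [A]. *)
rewrite [X in - X](big_setID A) /= setTI scaler_nat mulr2n opprD addrACA.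
by rewrite addNr add0r addrC.
Qed.

(** Only the empty subset of [p1_roots h] contributes. The inner sign comes from [P_K] being a
    Vandermonde determinant at the negated argument. *)
Lemma alternating_sumE (x : 'rV[C]_(p + q)) :
  alternating_sum h x = (-1) ^+ num_pos_on h *
    ((-1) ^+ (\sum_(i < p + q) i) * alternating_vandermonde x /
      vandermonde (iota_row C (p + q))).
Proof.
rewrite /alternating_sum; congr (_ * _).
rewrite p1_roots_eq0 pos_noncompact_levi_rootsE.
rewrite big_fpowerset_image; last exact: cross_roots_inj.
rewrite /alternating_vandermonde /alternating_shift powersetT.
rewrite big_distrr big_distrl /=; apply: eq_big => [A|A _]; first by rewrite inE.
rewrite fpowerset0 big_seq_fset1 cardfs0 addn0 shift_signed_sum P_KE.
rewrite card_imfset_fin; last by move=> ? ? _ _; apply: cross_roots_inj.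
have -> : #|[pred ij | ij \in A]| = #|A| by apply: eq_card.
by rewrite vandermondeN (mulrCA ((-1) ^+ (\sum_(i < p + q) i))) -[RHS]mulrA.
Qed.

End Assembly.

(** As [p q] is even, the exponent [N] has the parity of [r], and the signs from negating the
    arguments of [P_K] and [P_LK] agree. The Vandermonde constants cancel. *)
Lemma alternating_sum_even (R : realType) r s (x : 'rV[R[i]]_(r.*2 + s.*2)) :
  alternating_sum (h_real_form R (r.*2 + s.*2) r.*2) x =
    (-1) ^+ r * ('C(r + s, r))%:R * P_LK (h_real_form R (r.*2 + s.*2) r.*2) x.
Proof.
rewrite alternating_sumE P_LKE block_vandermondeN alternating_vandermonde_even.
rewrite -signr_odd odd_num_pos_on oddD oddM odd_double odd_sum_ord_double signr_odd /=.
have -> : (-1) ^+ (\sum_(i < r.*2 + s.*2) i) =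
    (-1) ^+ (\sum_(i < r.*2) i + \sum_(i < s.*2) i) :> R[i].
  by rewrite sum_ord_add -signr_odd oddD oddM odd_double addbF signr_odd.
have := vandermonde_iota_neq0 R[i] (r.*2 + s.*2).
have := vandermonde_iota_neq0 R[i] r.*2; have := vandermonde_iota_neq0 R[i] s.*2.
set e1 := (-1) ^+ r; set e2 := (-1) ^+ _; set b := block_vandermonde x.
set V := vandermonde _; set Vp := vandermonde _; set Vq := vandermonde _.
move: V Vp Vq b e1 e2 => V Vp Vq b e1 e2 V0 Vp0 Vq0.
by field; rewrite V0 Vp0 Vq0.
Qed.

(** This makes the constant unique; at the chosen point the polynomial takes the value 1. *)
Lemma P_LK_neq0 (R : realType) p q : exists x, P_LK (h_real_form R (p + q) p) x != 0.
Proof.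
exists (- row_mx (iota_row R[i] p) (iota_row R[i] q)).
rewrite P_LKE opprK /block_vandermonde row_mxKl row_mxKr.
by rewrite divff ?oner_eq0 // mulf_neq0 ?vandermonde_iota_neq0.
Qed.

Theorem theorem8p7 (R : realType) (n p r s : nat)
    (n_ge2 : (2 <= n)%N) (n_even : ~~ odd n)
    (p_even : ~~ odd p) (p_le_n : (p <= n)%N)
    (r_def : r = p./2) (s_def : s = (n - p)./2) (c : R[i]) :
  is_constant_of (h_real_form R n p) c <->
  c = (-1) ^+ p./2 * ('C(r + s, r))%:R.
Proof.
have pE : p = r.*2 by rewrite r_def even_halfK.
have nE : n = (r.*2 + s.*2)%N.
  by rewrite s_def even_halfK ?oddB ?(negbTE n_even) ?(negbTE p_even) // -pE subnKC.
rewrite -r_def pE nE; split=> [c_const | ->]; last exact: alternating_sum_even.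
have [x nz] := P_LK_neq0 R r.*2 s.*2.
by apply: (mulIf nz); rewrite -c_const alternating_sum_even.
Qed.
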